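(* Assume consistency, latent ignorability, IV independence, continuity and uniform boundedness, and positivity (as defined in the context). Fix $a\in\mathring{\mathcal A}$ and suppose that $\pi(Z,L)$ is a regular weighting function (RWF) for $A=a$. Then $$\mathbb E[\mu_\pi^o(a,L)]=\mathbb E\big[\mathbb E\{Y(a)\mid U,L\}\,\omega_{a,\pi}(U,L)\big],$$ $$\mathbb E[\mu_\pi^o(a,L)]-\mathbb E[Y(a)]=\mathbb E\big[\mathrm{Cov}\{\mathbb E\{Y(a)\mid U,L\},\,\omega_{a,\pi}(U,L)\mid L\}\big].$$ Furthermore, if $Z$ is an additive instrumental variable (AIV) for $A=a$, then $\theta(a):=\mathbb E[Y(a)]=\mathbb E[\mu_\pi^o(a,L)]$.
   Context: Setting. $Y\in\mathcal Y\subseteq\mathbb R$ is an outcome, $A$ a continuous treatment whose support $\mathcal A\subseteq\mathbb R$ is closed, $Z\in\mathcal Z\subseteq\mathbb R^{d_Z}$ an instrumental variable (IV, discrete or continuous), $L\in\mathcal L\subseteq\mathbb R^{d_L}$ observed confounders, $U\in\mathcal U\subseteq\mathbb R^{d_U}$ unobserved confounders, and $Y(a)$ the potential outcome under $A=a$. $p_{A\mid Z,U,L}(a\mid z,u,l)$, $p_{A\mid L}(a\mid l)$, etc. denote conditional densities. $\mathring{\mathcal A}$ is the interior of $\mathcal A$. Throughout, $p_{A\mid L}(a\mid L)>0$ for all $a\in\mathring{\mathcal A}$ almost surely. Assumptions. Consistency: $Y=Y(A)$. Latent ignorability: for any $a\in\mathring{\mathcal A}$, $Y(a)$ is independent of $\{A,Z\}$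 given $(U,L)$. IV independence: $Z$ is independent of $U$ given $L$. Continuity and uniform boundedness: for all $a\in\mathring{\mathcal A}$, $p_{A\mid Z,L}(a\mid Z,L)$ is continuous with respect to $a$ almost surely, and there exists $M(a)$ such that $p_{A\mid Z,L}(a\mid Z,L)\le M(a)$ almost surely. Positivity: for any $a\in\mathring{\mathcal A}$ there exists $\epsilon_1(a)>0$ such that $p_{A\mid L}(a\mid L)\ge\epsilon_1(a)$ almost surely. RWF. For measurable $\pi(Z,L)$ put $\kappa_\pi^o(A,L):=\mathbb E[\pi(Z,L)\mid A,L]-\mathbb E[\pi(Z,L)\mid L]$. A measurable $\pi:\mathcal Z\times\mathcal L\to\mathbb R$ is an RWF for $A=a$ if it is uniformly bounded and there is a constant $\epsilon_\pi(a)>0$ with $|\kappa_\pi^o(a,L)|\ge\epsilon_\pi(a)$ almost surely. AIV. $Z$ is an AIV for $A=a$ if there exist functions $b_a(U,L)$, $c_a(Z,L)$ such that $p_{A\mid Z,U,L}(a\mid Z,U,L)=b_a(U,L)+c_a(Z,L)$. Further notation. With $Z_\pi:=\pi(Z,L)$, $$\mu_\pi^o(a,l):=\frac{\mathbb E[YZ_\pi\mid A=a,L=l]-\mathbb E[Y\mid A=a,L=l]\,\mathbb E[Z_\pi\mid L=l]}{\mathbb E[Z_\pi\mid A=a,L=l]-\mathbb E[Z_\pi\mid L=l]},$$ $$\omega_{a,\pi}(U,L):=\frac{\mathrm{Cov}\{p_{A\mid Z,U,L}(a\mid Z,U,L),\pi(Z,L)\mid U,L\}}{\mathrm{Cov}\{p_{A\mid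 Z,U,L}(a\mid Z,U,L),\pi(Z,L)\mid L\}}.$$
   Formalization: Latent ignorability is also required at the value A=a, i.e. P(Y(a)∈B|A=a,Z,U,L)=P(Y(a)∈B|U,L), with compatible versions of P(·|A=a) and the densities; E|Y(a)|<∞ and E[|Y| | A=a]<∞ are assumed. *)

(* Defs.v *)
From HB Require Import structures.
From mathcomp Require Import all_boot all_order all_algebra.
From mathcomp Require Import all_classical all_reals all_analysis.

Set Implicit Arguments.
Unset Strict Implicit.
Unset Printing Implicit Defensive.

Import Order.TTheory GRing.Theory Num.Theory.
Import numFieldNormedType.Exports.

Local Open Scope classical_set_scope.
Local Open Scope ring_scope.

Section conditional_expectation.
Context {d d' : measure_display} {T : measurableType d} {T' : measurableType d'} {R : realType}.
Variable mu : {measure set T -> \bar R}.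

(* g is a version of v |-> E[X | V = v] under mu. *)
Definition is_condexp (V : T -> T') (X : T -> R) (g : T' -> R) : Prop :=
  [/\ measurable_fun setT g,
      mu.-integrable setT (EFin \o (g \o V)) &
      forall B : set T', measurable B ->
        (\int[mu]_(w in V @^-1` B) (g (V w))%:E =
         \int[mu]_(w in V @^-1` B) (X w)%:E)%E].

(* A chosen version; 0 when there is none (there is one as soon as X is
   mu-integrable, V is measurable and mu is finite). *)
Definition condexp (V : T -> T') (X : T -> R) : T' -> R :=
  xget (fun=> 0) [set g | is_condexp V X g].

(* v |-> Cov(X, W | V = v) = E[(X - E[X|V]) (W - E[W|V]) | V = v] *)
Definition condcov (V : T -> T') (X W : T -> R) : T' -> R :=
  condexp V (fun w => (X w - condexp V X (V w)) * (W w - condexp V W (V w))).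

End conditional_expectation.

(* X and W are conditionally independent given V *)
Definition cond_indep {d d1 d2 d3} {T : measurableType d}
    {T1 : measurableType d1} {T2 : measurableType d2} {T3 : measurableType d3}
    {R : realType} (P : {measure set T -> \bar R})
    (X : T -> T1) (W : T -> T2) (V : T -> T3) : Prop :=
  forall (B : set T1) (C : set T2), measurable B -> measurable C ->
    {ae P, forall w,
      condexp P V (\1_(X @^-1` B `&` W @^-1` C)) (V w) =
      condexp P V (\1_(X @^-1` B)) (V w) *
      condexp P V (\1_(W @^-1` C)) (V w)}.

Section continuous_treatment.
Context {d : measure_display} {T : measurableType d} {R : realType}.
Variables (P : probability T R) (A : T -> R).

(* the (closed) support of the law of A *)
Definition rv_support : set R :=
  [set x | forall e : R, 0 < e -> (0 < P (A @^-1` ball x e))%E].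

(* Conditioning on the null event {A = a} is only meaningful relative to a
   regular conditional probability: K a is P(. | A = a), it is carried by
   {A = a}, and E[X | A = a, V = v] is [condexp (K a) V X v]. *)
Definition is_cond_prob_given (K : R.-pker (measurableTypeR R) ~> T) : Prop :=
  (forall (B : set R) (E : set T), measurable B -> measurable E ->
    (P (A @^-1` B `&` E) = \int[P]_(w in A @^-1` B) K (A w) E)%E) /\
  (forall a, interior rv_support a -> K a (A @^-1` [set a]) = 1%E).

Definition is_density (pA : R -> R) : Prop :=
  [/\ measurable_fun setT pA, (forall x, 0 <= pA x) &
      forall B : set R, measurable B ->
        (P (A @^-1` B) = \int[lebesgue_measure]_(x in B) (pA x)%:E)%E].

(* p x v is the conditional density of A at x given V = v.  The last clause is
   Bayes' rule, pA(a) P(V in C | A = a) = E[p(a | V) 1{V in C}]; it follows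
   from the other ones for almost every a only, and says that the version of p
   evaluated at a is the one that goes with K a. *)
Definition is_cond_density (K : R.-pker (measurableTypeR R) ~> T)
    (pA : R -> R) {d'} {T' : measurableType d'} (V : T -> T')
    (p : R -> T' -> R) : Prop :=
  [/\ measurable_fun setT (fun xv : measurableTypeR R * T' => p xv.1 xv.2),
      (forall x v, 0 <= p x v),
      (forall (B : set R) (C : set T'), measurable B -> measurable C ->
        (P (A @^-1` B `&` V @^-1` C) =
         \int[P]_(w in V @^-1` C)
            \int[lebesgue_measure]_(x in B) (p x (V w))%:E)%E) &
      forall a, interior rv_support a -> forall C : set T', measurable C ->
        ((pA a)%:E * K a (V @^-1` C) =
         \int[P]_(w in V @^-1` C) (p a (V w))%:E)%E].

End continuous_treatment.

Section assumptions.
Context {d dz du dl : measure_display} {T : measurableType d} {R : realType}.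
Context {TZ : measurableType dz} {TU : measurableType du}
  {TL : measurableType dl}.
Variables (P : probability T R) (A Y : T -> R) (Ypot : R -> T -> R).
Variables (Z : T -> TZ) (U : T -> TU) (L : T -> TL).
Variable K : R.-pker (measurableTypeR R) ~> T.

Definition consistency : Prop := forall w, Y w = Ypot (A w) w.

(* For every a, Y(a) is independent of (A, Z) given (U, L).  The second clause
   is this same independence read at the value A = a of the treatment:
   P(Y(a) in B | A = a, Z, U, L) = P(Y(a) in B | U, L).  It has to be spelled
   out because {A = a} is P-null: the first clause alone does not relate the
   laws of Y(a) under P and under P(. | A = a) (if Y(a) = 1{A = a}, the first
   clause holds trivially, while Y = Y(A) = 1 and Y(a) = 0 P-a.s.). *)
Definition latent_ignorability : Prop :=
  forall a, interior (rv_support P A) a ->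
    cond_indep P (Ypot a) (fun w => (A w, Z w)) (fun w => (U w, L w)) /\
    forall B : set R, measurable B ->
      {ae K a, forall w,
        condexp (K a) (fun w => (Z w, U w, L w))
          (\1_(Ypot a @^-1` B)) (Z w, U w, L w) =
        condexp P (fun w => (U w, L w))
          (\1_(Ypot a @^-1` B)) (U w, L w)}.

Definition IV_independence : Prop := cond_indep P Z U L.

Definition continuity_boundedness (pAZL : R -> TZ * TL -> R) : Prop :=
  forall a, interior (rv_support P A) a ->
    {ae P, forall w, {for a, continuous (fun x : R => pAZL x (Z w, L w))}} /\
    exists M : R, {ae P, forall w, pAZL a (Z w, L w) <= M}.

Definition overlap (pAL : R -> TL -> R) : Prop :=
  forall a, interior (rv_support P A) a -> {ae P, forall w, 0 < pAL a (L w)}.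

Definition positivity (pAL : R -> TL -> R) : Prop :=
  forall a, interior (rv_support P A) a ->
    exists2 e1 : R, 0 < e1 & {ae P, forall w, e1 <= pAL a (L w)}.

Section weighting.
Variable pi : TZ * TL -> R.

Let Zpi (w : T) : R := pi (Z w, L w).

Definition kappa (a : R) (l : TL) : R := condexp (K a) L Zpi l - condexp P L Zpi l.

Definition is_RWF (a : R) : Prop :=
  [/\ measurable_fun setT pi,
      (exists C : R, forall x, `|pi x| <= C) &
      exists2 e : R, 0 < e & {ae P, forall w, e <= `|kappa a (L w)|}].

Definition mu_o (a : R) (l : TL) : R :=
  (condexp (K a) L (fun w => Y w * Zpi w) l -
   condexp (K a) L Y l * condexp P L Zpi l) /
  (condexp (K a) L Zpi l - condexp P L Zpi l).

Definition omega (pAZUL : R -> TZ * TU * TL -> R) (a : R) (ul : TU * TL) : R :=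
  condcov P (fun w => (U w, L w)) (fun w => pAZUL a (Z w, U w, L w)) Zpi ul /
  condcov P L (fun w => pAZUL a (Z w, U w, L w)) Zpi ul.2.

End weighting.

Definition is_AIV (pAZUL : R -> TZ * TU * TL -> R) (a : R) : Prop :=
  exists (b : TU * TL -> R) (c : TZ * TL -> R),
    [/\ measurable_fun setT b, measurable_fun setT c &
        {ae P, forall w,
          pAZUL a (Z w, U w, L w) = b (U w, L w) + c (Z w, L w)}].

End assumptions.

(* Main.v *)
Require Import Defs.
From HB Require Import structures.
From mathcomp Require Import all_boot all_order all_algebra.
From mathcomp Require Import all_classical all_reals all_analysis.
From mathcomp Require Import measurable_realfun ring.

Set Implicit Arguments.
Unset Strict Implicit.
Unset Printing Implicit Defensive.

Import Order.TTheory GRing.Theory Num.Theory.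
Import numFieldNormedType.Exports.

Local Open Scope classical_set_scope.
Local Open Scope ring_scope.

(* Write Q for P(. | A = a), p for the density of A at a given (Z, U, L), and
   Zc for pi(Z, L) - E[pi(Z, L) | L].  By Bayes' rule p / pA(a) is the density
   under Q, relative to P, of the law of (Z, U, L); together with latent
   ignorability this turns every conditional expectation under Q of Y h(Z, L)
   given L into one under P of m(U, L) h(Z, L) p, where m = E[Y(a) | U, L].
   Hence mu_o(L) = E[m p Zc | L] / E[p Zc | L], the denominator being bounded
   away from 0 by positivity and the RWF condition.  IV independence gives
   E[pi(Z, L) | U, L] = E[pi(Z, L) | L], so that conditioning on (U, L) first
   produces omega = E[p Zc | U, L] / E[p Zc | L], whose conditional mean given
   L is 1; this is the first formula, and the covariance formula follows.
   For an AIV, p = b(U, L) + c(Z, L) and b contributes nothing to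
   E[p Zc | U, L], which is then a function of L alone, i.e. omega = 1. *)

(** * Weighted laws *)

Lemma finite_measure_of_measure d (T : measurableType d) (R : realType)
  (M : {measure set T -> \bar R}) : fin_num_fun M ->
  exists N : {finite_measure set T -> \bar R}, N = M :> {measure set T -> \bar R}.
Proof.
case: M => s c finM.
pose M := Measure.Pack c.
pose F := Measure_isFinite.Build _ _ _ M finM.
by exists (HB.pack_for {finite_measure set T -> \bar R} s M F).
Qed.

(** The kernel value [K a] is by type a mere measure; this repackages it, up to equality of
    measures, so that what is proved for probabilities applies to it. *)
Lemma probability_of_measure d (T : measurableType d) (R : realType)
  (M : {measure set T -> \bar R}) : M setT = 1%E ->
  exists N : probability T R, N = M :> {measure set T -> \bar R}.
Proof.
case: M => s c M1.
pose M := Measure.Pack c.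
pose F := Measure_isProbability.Build _ _ _ M M1.
by exists (HB.pack_for (probability T R) s M F).
Qed.

Section weighted_law.
Context {d : measure_display} {T : measurableType d} {R : realType}.
Variables (P : probability T R).
Local Open Scope ereal_scope.

(** The measure sends B to the integral of [f] over B. It is dominated by [P], and its Radon-Nikodym
    derivative has the same integrals as [f] over all measurable sets, hence equals [f] almost
    everywhere; change of variables then gives the second clause. *)
Lemma density_measure (f : T -> \bar R) : P.-integrable setT f ->
  (forall w, 0 <= f w) ->
  exists nu : {finite_measure set T -> \bar R},
    (forall B, measurable B -> nu B = \int[P]_(w in B) f w) /\
    (forall g : T -> \bar R, measurable_fun setT g -> (forall x, 0 <= g x) ->
      \int[nu]_x g x = \int[P]_w (g w * f w)).
Proof.
move=> intf f0; have mf := measurable_int _ intf.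
pose nu B := \int[P]_(w in B) f w.
have nu0 : nu set0 = 0 by rewrite /nu integral_set0.
have nuge0 B : 0 <= nu B by apply: integral_ge0.
pose nuM := isMeasure.Build _ _ _ nu nu0 nuge0
  (semi_sigma_additive_nng_induced mf f0).
have nufin : fin_num_fun nu.
  by move=> B mB; apply: integrable_fin_num => //; exact: integrableS intf.
pose M : {measure set T -> \bar R} := HB.pack nu nuM.
pose nuF := Measure_isFinite.Build _ _ _ M nufin.
pose N : {finite_measure set T -> \bar R} := HB.pack nu nuM nuF.
have NP : N `<< P.
  apply/null_content_dominatesP => B mB PB0.
  by apply: null_set_integral => //; exact: measurable_funTS.
exists N; split => // g mg g0.
rewrite -(Radon_Nikodym_SigmaFinite.change_of_variables NP)//.
have h := Radon_Nikodym_SigmaFinite.f_ge0 NP.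
have mh := measurable_int P (Radon_Nikodym_SigmaFinite.f_integrable NP).
apply: ge0_ae_eq_integral => //.
- exact: emeasurable_funM.
- exact: emeasurable_funM.
- by move=> w _; rewrite mule_ge0.
- by move=> w _; rewrite mule_ge0.
apply: ae_eqe_mul2l; apply: integral_ae_eq => //.
  exact: Radon_Nikodym_SigmaFinite.f_integrable.
by move=> E _ mE; rewrite -Radon_Nikodym_SigmaFinite.f_integral.
Qed.

(** The image under [V] of the measure f dP. Integrals of functions of [V] weighted by [f] become
    plain integrals on [T'], where measures can be compared. *)
Lemma weighted_law {d'} {T' : measurableType d'} (V : T -> T') (f : T -> \bar R) :
  measurable_fun setT V -> P.-integrable setT f -> (forall w, 0 <= f w) ->
  exists nu : {finite_measure set T' -> \bar R},
    (forall B, measurable B -> nu B = \int[P]_(w in V @^-1` B) f w) /\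
    (forall g : T' -> \bar R, measurable_fun setT g -> (forall x, 0 <= g x) ->
      \int[nu]_x g x = \int[P]_w (g (V w) * f w)).
Proof.
move=> mV intf f0; have [nu [nuE nug]] := density_measure intf f0.
have [M ME] : exists M : {measure set T' -> \bar R}, M = pushforward nu V :> (_ -> _).
  by apply: (ex_intro _ (pushforward nu V : {measure set T' -> \bar R})) => //.
have Mfin : fin_num_fun M.
  move=> B mB; rewrite ME; apply: fin_num_measure.
  by rewrite -[X in measurable X]setTI; exact: mV.
have [N NM] := finite_measure_of_measure Mfin.
have NE B : N B = nu (V @^-1` B).
  by rewrite -[RHS](congr1 (@^~ B) ME) -[in RHS]NM.
exists N; split => [B mB|g mg g0].
  by rewrite NE nuE// -[X in measurable X]setTI; exact: mV.
transitivity (\int[pushforward nu V]_x g x).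
  by apply: eq_measure_integral => B _ _; exact: NE.
by rewrite ge0_integral_pushforward//= nug//; exact: measurableT_comp.
Qed.

End weighted_law.

Local Notation intg P X := (P.-integrable setT (EFin \o X)).

Lemma maxr0B (R : realDomainType) (x : R) : Num.max x 0 - Num.max (- x) 0 = x.
Proof.
case: (leP x 0) => x0; first by rewrite max_l ?oppr_ge0// opprK add0r.
by rewrite max_r ?subr0// oppr_le0 ltW.
Qed.

Lemma measurable_preimage d d' (T : measurableType d) (T' : measurableType d')
  (V : T -> T') (B : set T') :
  measurable_fun setT V -> measurable B -> measurable (V @^-1` B).
Proof. by move=> mV mB; rewrite -[X in measurable X]setTI; exact: mV. Qed.

(** * Transfer of integrals between two weighted laws *)

Section transfer.
Context {d1 d2 d' : measure_display} {T1 : measurableType d1}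
  {T2 : measurableType d2} {T' : measurableType d'} {R : realType}.
Variables (P1 : probability T1 R) (P2 : probability T2 R).
Variables (V1 : T1 -> T') (V2 : T2 -> T') (f1 : T1 -> R) (f2 : T2 -> R).
Hypotheses (mV1 : measurable_fun setT V1) (mV2 : measurable_fun setT V2).
Hypotheses (intf1 : intg P1 f1) (intf2 : intg P2 f2).
Hypotheses (f10 : forall w, 0 <= f1 w) (f20 : forall w, 0 <= f2 w).

(** The images of f1 dP1 under [V1] and of f2 dP2 under [V2] coincide. Both a conditional
    expectation (weights X and g(V), on one space) and Bayes' rule (weight c under Q, weight p(V)
    under P) take this form. *)
Definition same_weighted_law := forall B : set T', measurable B ->
  (\int[P1]_(w in V1 @^-1` B) (f1 w)%:E = \int[P2]_(w in V2 @^-1` B) (f2 w)%:E)%E.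

Lemma ge0_transfer (g : T' -> \bar R) : same_weighted_law ->
  measurable_fun setT g -> (forall x, 0 <= g x)%E ->
  (\int[P1]_w (g (V1 w) * (f1 w)%:E) = \int[P2]_w (g (V2 w) * (f2 w)%:E))%E.
Proof.
move=> swl mg g0.
have [nu1 [nu1E nu1g]] := weighted_law mV1 intf1 f10.
have [nu2 [nu2E nu2g]] := weighted_law mV2 intf2 f20.
rewrite -[LHS]nu1g// -[RHS]nu2g//; apply: eq_measure_integral => B mB _.
by etransitivity; [exact: nu1E|rewrite swl//; exact/esym/nu2E].
Qed.

(** An integral is the difference of the integrals of the positive and negative parts, and a
    nonnegative weight factors out of both parts, so the nonnegative case applies to each. *)
Lemma transfer (g : T' -> R) : same_weighted_law -> measurable_fun setT g ->
  (\int[P1]_w (g (V1 w) * f1 w)%:E = \int[P2]_w (g (V2 w) * f2 w)%:E)%E.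
Proof.
move=> swl mg.
have posM (x : \bar R) (y : R) : 0 <= y -> (maxe (x * y%:E) 0 = maxe x 0 * y%:E)%E.
  by move=> y0; rewrite maxe_pMl ?mul0e// lee_fin.
have mgE : measurable_fun setT (EFin \o g) by exact/measurable_EFinP.
rewrite integralE [RHS]integralE; congr (_ - _)%E.
- rewrite (_ : (fun w => _)^\+%E = fun w => ((EFin \o g)^\+ (V1 w) * (f1 w)%:E)%E).
    rewrite (_ : (fun w => _)^\+%E = fun w => ((EFin \o g)^\+ (V2 w) * (f2 w)%:E)%E).
      by apply: ge0_transfer => //; exact: measurable_funepos.
    by apply/funext => w; rewrite !funeposE /= EFinM posM.
  by apply/funext => w; rewrite !funeposE /= EFinM posM.
- rewrite (_ : (fun w => _)^\-%E = fun w => ((EFin \o g)^\- (V1 w) * (f1 w)%:E)%E).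
    rewrite (_ : (fun w => _)^\-%E = fun w => ((EFin \o g)^\- (V2 w) * (f2 w)%:E)%E).
      by apply: ge0_transfer => //; exact: measurable_funeneg.
    by apply/funext => w; rewrite !funenegE /= -mulNr EFinM posM.
  by apply/funext => w; rewrite !funenegE /= -mulNr EFinM posM.
Qed.

(** The restriction to the preimage of [B] is absorbed into [g] as an indicator factor. *)
Lemma transfer_set (g : T' -> R) (B : set T') :
  same_weighted_law -> measurable_fun setT g -> measurable B ->
  (\int[P1]_(w in V1 @^-1` B) (g (V1 w) * f1 w)%:E =
   \int[P2]_(w in V2 @^-1` B) (g (V2 w) * f2 w)%:E)%E.
Proof.
move=> swl mg mB;
rewrite integral_mkcond [RHS]integral_mkcond.
have patchM (S : Type) (V : S -> T') (f : S -> R) :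
    (fun w => (g (V w) * f w)%:E) \_ (V @^-1` B) =
    (fun w => ((g \* \1_B)%R (V w) * f w)%:E) :> (S -> \bar R).
  apply/funext => w; rewrite patchE /= indicE.
  have -> : (w \in V @^-1` B) = (V w \in B) by apply/idP/idP => /[!inE].
  by case: (V w \in B); rewrite ?mulr1 ?mulr0 ?mul0r.
rewrite !patchM; apply: transfer => //.
exact: measurable_funM.
Qed.

(** Transfer applied to the absolute value of [g] shows that the two absolute moments are equal. *)
Lemma transfer_integrable (g : T' -> R) : same_weighted_law ->
  measurable_fun setT g ->
  intg P1 (fun w => g (V1 w) * f1 w) -> intg P2 (fun w => g (V2 w) * f2 w).
Proof.
move=> swl mg /integrableP[_ fin]; apply/integrableP; split.
  apply/measurable_EFinP; apply: measurable_funM.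
    exact: measurableT_comp.
  exact/measurable_EFinP/(measurable_int _ intf2).
move: fin; congr (_ < _)%E.
under eq_integral do rewrite /= normrM (ger0_norm (f10 _)).
under [RHS]eq_integral do rewrite /= normrM (ger0_norm (f20 _)).
apply: (@transfer (Num.norm \o g)) => //.
exact: measurableT_comp.
Qed.

End transfer.

(** * Conditional expectation *)

Section integrability.
Context {d : measure_display} {T : measurableType d} {R : realType}.
Variable P : probability T R.
Implicit Types X W : T -> R.

Lemma intg_measurable X : intg P X -> measurable_fun setT X.
Proof. by move=> /measurable_int /measurable_EFinP. Qed.

Lemma intgB X W : intg P X -> intg P W -> intg P (fun w => X w - W w).
Proof. by move=> iX iW; exact: (integrableB measurableT iX iW). Qed.

Lemma intgD X W : intg P X -> intg P W -> intg P (fun w => X w + W w).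
Proof. by move=> iX iW; exact: (integrableD measurableT iX iW). Qed.

Lemma intg_dom X W : measurable_fun setT X -> intg P W ->
  {ae P, forall w, `|X w| <= `|W w|} -> intg P X.
Proof.
move=> mX /integrableP[/measurable_EFinP mW iW] XW.
apply/integrableP; split; first exact/measurable_EFinP.
apply: le_lt_trans iW; apply: ae_ge0_le_integral => //.
- by do 2 apply: measurableT_comp => //.
- by do 2 apply: measurableT_comp => //.
by apply: filterS XW => w h _; rewrite /= lee_fin.
Qed.

Lemma intg_ae X W : measurable_fun setT X -> intg P W ->
  {ae P, forall w, X w = W w} -> intg P X.
Proof.
move=> mX iW XW; apply: (intg_dom mX iW).
by apply: filterS XW => w ->.
Qed.

Lemma intgMl (c : R) X W : measurable_fun setT W -> intg P X ->
  {ae P, forall w, `|W w| <= c} -> intg P (fun w => W w * X w).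
Proof.
move=> mW iX Wc; have mX := intg_measurable iX.
apply: (@intg_dom _ (fun w => c * X w)).
- exact: measurable_funM.
- exact: (integrableZl measurableT c iX).
apply: filterS Wc => w Wc; rewrite !normrM ler_wpM2r//.
exact: le_trans (ler_norm _).
Qed.

Lemma intg_cst (c : R) : intg P (cst c).
Proof. exact: finite_measure_integrable_cst. Qed.

Lemma intg_bounded (c : R) W : measurable_fun setT W ->
  {ae P, forall w, `|W w| <= c} -> intg P W.
Proof.
move=> mW Wc; apply: (intg_ae mW (intgMl mW (intg_cst 1) Wc)).
by apply: aeW => w; rewrite mulr1.
Qed.

Lemma eq_integral_ae X W (B : set T) : measurable B ->
  measurable_fun setT X -> measurable_fun setT W ->
  {ae P, forall w, X w = W w} ->
  (\int[P]_(w in B) (X w)%:E = \int[P]_(w in B) (W w)%:E)%E.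
Proof.
move=> mB mX mW XW; apply: ae_eq_integral => //.
- exact/measurable_funTS/measurable_EFinP.
- exact/measurable_funTS/measurable_EFinP.
by apply: filterS XW => w -> _.
Qed.

End integrability.

Section condexp_theory.
Context {d d' : measure_display} {T : measurableType d} {T' : measurableType d'}
  {R : realType}.
Variables (P : probability T R) (V : T -> T').
Hypothesis mV : measurable_fun setT V.
Implicit Types (X : T -> R) (g h : T' -> R).

Lemma is_condexp_intg X g : is_condexp P V X g -> intg P (fun w => g (V w)).
Proof. by case. Qed.

Lemma is_condexp_measurable X g : is_condexp P V X g -> measurable_fun setT g.
Proof. by case. Qed.

Lemma is_condexp_integral X g : is_condexp P V X g ->
  (\int[P]_w (g (V w))%:E = \int[P]_w (X w)%:E)%E.
Proof. by case=> _ _ /(_ setT measurableT); rewrite preimage_setT. Qed.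

Lemma condexp_measurable X : measurable_fun setT (condexp P V X).
Proof.
rewrite /condexp; case: xgetP => [g _ [] //|_]; exact: measurable_cst.
Qed.

(** The version is the Radon-Nikodym derivative, with respect to the law of [V], of the image of X
    dP under [V]. Nonnegativity everywhere, not just almost surely, is recorded because the transfer
    lemmas ask it of weights. *)
Lemma is_condexp_ge0_exists X : intg P X -> (forall w, 0 <= X w) ->
  exists2 g, is_condexp P V X g & forall v, 0 <= g v.
Proof.
move=> iX X0.
have [|nu [nuE _]] := weighted_law mV iX; first by move=> w; rewrite lee_fin.
pose mf := HB.pack_for {mfun T >-> T'} V (isMeasurableFun.Build _ _ _ _ V mV).
pose D := distribution P mf.
have nuD : nu `<< D.
  apply/null_content_dominatesP => B mB PB0.
  etransitivity; first exact: nuE.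
  apply: null_set_integral => //; first exact: measurable_preimage.
  by apply: measurable_funTS; exact: measurable_int iX.
pose g0 := Radon_Nikodym_SigmaFinite.f nu D.
have g00 := Radon_Nikodym_SigmaFinite.f_ge0 nuD.
have gfin := Radon_Nikodym_SigmaFinite.f_fin_num nuD.
have ig := Radon_Nikodym_SigmaFinite.f_integrable nuD.
have gE := Radon_Nikodym_SigmaFinite.f_integral nuD.
have mg0 := measurable_int _ ig.
have mg : measurable_fun setT (fine \o g0).
  by apply: measurableT_comp => //; exact: measurable_fine.
have fineg v : (fine (g0 v))%:E = g0 v by rewrite fineK.
exists (fine \o g0); last by move=> v; rewrite /= fine_ge0.
split => //.
- apply/integrableP; split; first by apply/measurable_EFinP/measurableT_comp.
  case/integrableP: ig => _; rewrite ge0_integral_pushforward//; last first.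
    exact: measurableT_comp.
  congr (_ < _)%E; apply: eq_integral => w _.
  exact: (congr1 abse (esym (fineg _))).
- move=> B mB; rewrite -[RHS]nuE// gE// ge0_integral_pushforward//.
    by apply: eq_integral => w _ /=; rewrite fineg.
  exact: measurable_funTS.
Qed.

Lemma is_condexpB X1 X2 g1 g2 : intg P X1 -> intg P X2 ->
  is_condexp P V X1 g1 -> is_condexp P V X2 g2 ->
  is_condexp P V (fun w => X1 w - X2 w) (fun v => g1 v - g2 v).
Proof.
move=> iX1 iX2 [mg1 ig1 g1E] [mg2 ig2 g2E]; split.
- exact: measurable_funB.
- exact: intgB.
move=> B mB; have mVB := measurable_preimage mV mB.
have iS Y : intg P Y -> P.-integrable (V @^-1` B) (EFin \o Y).
  by move=> iY; exact: integrableS iY.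
rewrite !integralB_EFin//; try exact: iS.
by rewrite g1E// g2E.
Qed.

Lemma is_condexp_exists X : intg P X -> exists g, is_condexp P V X g.
Proof.
move=> iX; have mX := intg_measurable iX.
have iXp : intg P (fun w => Num.max (X w) 0) by exact: integrable_funrpos.
have iXn : intg P (fun w => Num.max (- X w) 0) by exact: integrable_funrneg.
have [|gp gpE _] := is_condexp_ge0_exists iXp.
  by move=> w; rewrite le_max lexx orbT.
have [|gn gnE _] := is_condexp_ge0_exists iXn.
  by move=> w; rewrite le_max lexx orbT.
have := is_condexpB iXp iXn gpE gnE.
rewrite (_ : (fun w => _ - _) = X); first by exists (fun v => gp v - gn v).
by apply/funext => w; rewrite maxr0B.
Qed.

Lemma condexpP X : intg P X -> is_condexp P V X (condexp P V X).
Proof. by move=> iX; apply: xgetPex; exact: is_condexp_exists. Qed.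

(** Both versions have the same integral over every set under the law of [V], so they agree outside
    a null set of that law, which [V] pulls back to a [P]-null set. *)
Lemma is_condexp_uniq X g1 g2 : is_condexp P V X g1 -> is_condexp P V X g2 ->
  {ae P, forall w, g1 (V w) = g2 (V w)}.
Proof.
move=> [mg1 ig1 g1E] [mg2 ig2 g2E].
pose mf := HB.pack_for {mfun T >-> T'} V (isMeasurableFun.Build _ _ _ _ V mV).
have : ae_eq (distribution P mf) setT (EFin \o g1) (EFin \o g2).
  apply: integral_ae_eq => //.
  - apply: (@integrable_pushforward _ _ _ _ _ V) => //; exact/measurable_EFinP.
  - exact/measurable_EFinP.
  - move=> B _ mB.
    rewrite !(integral_pushforward mV)//.
    + by rewrite [LHS]g1E// [RHS]g2E.
    + exact/measurable_EFinP.
    + by apply: integrableS ig2 => //; exact: measurable_preimage.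
    + exact/measurable_EFinP.
    + by apply: integrableS ig1 => //; exact: measurable_preimage.
move=> [N [mN N0 Nsub]]; exists (V @^-1` N); split => //.
  exact: measurable_preimage.
by move=> w /= h; apply: Nsub => /=; apply: contra_not h => /(_ I)[].
Qed.

Lemma is_condexp_ae_eq_arg X1 X2 g : measurable_fun setT X1 ->
  measurable_fun setT X2 -> {ae P, forall w, X1 w = X2 w} ->
  is_condexp P V X1 g -> is_condexp P V X2 g.
Proof.
move=> mX1 mX2 X12 [mg ig gE]; split => // B mB; rewrite gE//.
by apply: eq_integral_ae => //; exact: measurable_preimage.
Qed.

Lemma is_condexp_ae_eq X g1 g2 : measurable_fun setT g2 ->
  {ae P, forall w, g1 (V w) = g2 (V w)} ->
  is_condexp P V X g1 -> is_condexp P V X g2.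
Proof.
move=> mg2 g12 [mg1 ig1 g1E].
have mg2V : measurable_fun setT (g2 \o V) by exact: measurableT_comp.
split => //.
  by apply: (intg_ae mg2V ig1); apply: filterS g12 => w /= ->.
move=> B mB; rewrite -g1E//; apply: eq_integral_ae => //.
- exact: measurable_preimage.
- exact: measurableT_comp.
- by apply: filterS g12 => w /= ->.
Qed.

Lemma is_condexp_comp h : measurable_fun setT h -> intg P (h \o V) ->
  is_condexp P V (h \o V) h.
Proof. by []. Qed.

Lemma is_condexp_cst (c : R) : is_condexp P V (cst c) (cst c).
Proof. by apply: (@is_condexp_comp (cst c)) => //; exact: intg_cst. Qed.

Lemma is_condexpD X1 X2 g1 g2 : intg P X1 -> intg P X2 ->
  is_condexp P V X1 g1 -> is_condexp P V X2 g2 ->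
  is_condexp P V (fun w => X1 w + X2 w) (fun v => g1 v + g2 v).
Proof.
move=> iX1 iX2 h1 h2.
(* The sum is written X1 - (0 - X2), which leaves only differences to treat. *)
have i0 := intg_cst P 0.
have := is_condexpB iX1 (intgB i0 iX2) h1
  (is_condexpB i0 iX2 (is_condexp_cst 0) h2).
congr is_condexp; apply/funext => w /=; by rewrite opprB subr0.
Qed.

(** The difference X2 - X1 equals its positive part almost surely, and the latter has a nonnegative
    version; uniqueness carries the sign over to g2 - g1. *)
Lemma is_condexp_le X1 X2 g1 g2 : intg P X1 -> intg P X2 ->
  is_condexp P V X1 g1 -> is_condexp P V X2 g2 ->
  {ae P, forall w, X1 w <= X2 w} -> {ae P, forall w, g1 (V w) <= g2 (V w)}.
Proof.
move=> iX1 iX2 h1 h2 X12.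
pose X w := Num.max (X2 w - X1 w) 0.
have XE : {ae P, forall w, X2 w - X1 w = X w}.
  by apply: filterS X12 => w h; rewrite /X max_l// subr_ge0.
have iD := intgB iX2 iX1; have mD := intg_measurable iD.
have mX : measurable_fun setT X by exact: measurable_maxr.
have XE' : {ae P, forall w, X w = X2 w - X1 w} by apply: filterS XE.
have iX : intg P X by exact: intg_ae iD XE'.
have [|g gE g0] := is_condexp_ge0_exists iX.
  by move=> w; rewrite le_max lexx orbT.
have := is_condexp_uniq
  (is_condexp_ae_eq_arg mD mX XE (is_condexpB iX2 iX1 h2 h1)) gE.
by apply: filterS => w E; rewrite -subr_ge0 E.
Qed.

Lemma is_condexp_bound (c : R) X g : measurable_fun setT X ->
  is_condexp P V X g -> {ae P, forall w, `|X w| <= c} ->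
  {ae P, forall w, `|g (V w)| <= c}.
Proof.
move=> mX Xg Xc; have iX := intg_bounded mX Xc.
have up : {ae P, forall w, g (V w) <= c}.
  apply: (is_condexp_le iX (intg_cst P c) Xg (is_condexp_cst c)).
  by apply: filterS Xc => w; exact: le_trans (ler_norm _).
have low : {ae P, forall w, - c <= g (V w)}.
  apply: (is_condexp_le (intg_cst P (- c)) iX (is_condexp_cst (- c)) Xg).
  by apply: filterS Xc => w; rewrite ler_norml => /andP[].
by apply: filterS2 up low => w h1 h2; rewrite ler_norml h1 h2.
Qed.

(** On the event where a nonnegative version vanishes, [X] integrates to 0 and so is 0 almost
    surely; as [X] is positive, that event is null. *)
Lemma is_condexp_gt0 X g : intg P X -> (forall w, 0 < X w) ->
  is_condexp P V X g -> {ae P, forall w, 0 < g (V w)}.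
Proof.
move=> iX X0 Xg.
have [g' Xg' g'0] := is_condexp_ge0_exists iX (fun w => ltW (X0 w)).
have [mg' ig' g'E] := Xg'.
pose N := g' @^-1` [set 0].
have mN : measurable N by exact: measurable_preimage.
have mVN := measurable_preimage mV mN.
have intN : (\int[P]_(w in V @^-1` N) `|(X w)%:E| = 0)%E.
  under eq_integral do rewrite gee0_abs ?lee_fin ?(ltW (X0 _))//.
  rewrite -g'E// integral0_eq// => w; rewrite /N /= => -> //.
have mX : measurable_fun (V @^-1` N) (EFin \o X).
  by apply: measurable_funTS; exact: measurable_int iX.
have ae0 := (ae_eq_integral_abs P mVN mX).1 intN.
have gg' := is_condexp_uniq Xg Xg'.
apply: filterS2 ae0 gg' => w + -> => h; rewrite lt_neqAle g'0 andbT.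
apply/eqP => g'V0; have /h/eqP : (V @^-1` N) w by rewrite /N /= -g'V0.
by rewrite eqe gt_eqF.
Qed.

Lemma is_condexp_same_law X g :
  is_condexp P V X g -> same_weighted_law P P V V X (g \o V).
Proof. by case=> _ _ gE B mB; rewrite [RHS]gE. Qed.

Lemma is_condexp_mull_ge0 X g h : intg P X -> (forall w, 0 <= X w) ->
  (forall v, 0 <= g v) -> measurable_fun setT h -> is_condexp P V X g ->
  intg P (fun w => h (V w) * X w) ->
  is_condexp P V (fun w => h (V w) * X w) (fun v => h v * g v).
Proof.
move=> iX X0 g0 mh Xg ihX; have [mg ig gE] := Xg.
have swl := is_condexp_same_law Xg.
have gV0 w : 0 <= (g \o V) w by exact: g0.
split; first exact: measurable_funM.
  exact: (transfer_integrable mV mV iX ig X0 gV0 swl).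
by move=> B mB; rewrite (transfer_set mV mV iX ig X0 gV0 swl mh mB).
Qed.

(** The same transfer read backwards, from g(V) dP to X dP; it gives integrability of products whose
    factor [h] may be unbounded. The version [g] is first exchanged for a nonnegative one. *)
Lemma intg_mull_condexp X g h : intg P X -> (forall w, 0 <= X w) ->
  measurable_fun setT h -> is_condexp P V X g ->
  intg P (fun w => h (V w) * g (V w)) -> intg P (fun w => h (V w) * X w).
Proof.
move=> iX X0 mh Xg ihg; have [g' Xg' g'0] := is_condexp_ge0_exists iX X0.
have gg' := is_condexp_uniq Xg Xg'.
have swl B : measurable B -> _ := fun mB => esym (is_condexp_same_law Xg' mB).
have g'V0 w : 0 <= (g' \o V) w by exact: g'0.
have [mg' ig' _] := Xg'.
apply: (transfer_integrable mV mV ig' iX g'V0 X0 swl mh).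
apply: (intg_ae _ ihg).
  apply: measurable_funM; first exact: measurableT_comp.
  exact: intg_measurable ig'.
by apply: filterS gg' => w /= ->.
Qed.

(** The positive and negative parts of [X] are dominated by its absolute value, so their products
    with h(V) stay integrable and the nonnegative case applies to each. *)
Lemma is_condexp_mull X g h : intg P X -> measurable_fun setT h ->
  is_condexp P V X g -> intg P (fun w => h (V w) * X w) ->
  is_condexp P V (fun w => h (V w) * X w) (fun v => h v * g v).
Proof.
move=> iX mh Xg ihX; have mX := intg_measurable iX.
pose Xp w := Num.max (X w) 0; pose Xn w := Num.max (- X w) 0.
have iXp : intg P Xp by exact: integrable_funrpos.
have iXn : intg P Xn by exact: integrable_funrneg.
have Xp0 w : 0 <= Xp w by rewrite le_max lexx orbT.
have Xn0 w : 0 <= Xn w by rewrite le_max lexx orbT.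
have XE w : X w = Xp w - Xn w by rewrite /Xp /Xn maxr0B.
have Xp_le w : `|Xp w| <= `|X w|.
  rewrite ger0_norm// /Xp; case: (leP (X w) 0) => // _; exact: ler_norm.
have Xn_le w : `|Xn w| <= `|X w|.
  by rewrite ger0_norm// ge_max normr_ge0 andbT -normrN ler_norm.
have ihp : intg P (fun w => h (V w) * Xp w).
  apply: (intg_dom _ ihX); last by apply: aeW => w; rewrite !normrM ler_wpM2l.
  by apply: measurable_funM; [exact: measurableT_comp|exact: intg_measurable iXp].
have ihn : intg P (fun w => h (V w) * Xn w).
  apply: (intg_dom _ ihX); last by apply: aeW => w; rewrite !normrM ler_wpM2l.
  by apply: measurable_funM; [exact: measurableT_comp|exact: intg_measurable iXn].
have [gp gpE gp0] := is_condexp_ge0_exists iXp Xp0.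
have [gn gnE gn0] := is_condexp_ge0_exists iXn Xn0.
have hp := is_condexp_mull_ge0 iXp Xp0 gp0 mh gpE ihp.
have hn := is_condexp_mull_ge0 iXn Xn0 gn0 mh gnE ihn.
have := is_condexpB ihp ihn hp hn.
rewrite (_ : (fun w => _ - _) = (fun w => h (V w) * X w)); last first.
  by apply/funext => w; rewrite -mulrBr -XE.
apply: is_condexp_ae_eq.
  by apply: measurable_funM => //; case: Xg.
have := is_condexpB iXp iXn gpE gnE.
rewrite (_ : (fun w => _ - _) = X); last by apply/funext => w; rewrite -XE.
move=> /(is_condexp_uniq Xg); apply: filterS => w E.
by rewrite -mulrBr E.
Qed.

(* Only one of the two factors has to be centered: the projection
   [E[X | V] (W - E[W | V])] has zero conditional expectation. *)
Lemma condcovP X (W : T -> R) (c : R) : intg P X -> measurable_fun setT W ->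
  {ae P, forall w, `|W w| <= c} ->
  is_condexp P V (fun w => (W w - condexp P V W (V w)) * X w) (condcov P V X W).
Proof.
move=> iX mW Wc; have iW := intg_bounded mW Wc.
have eX := condexpP iX; have eW := condexpP iW.
set x := condexp P V X in eX *; set y := condexp P V W in eW *.
have yc := is_condexp_bound mW eW Wc.
pose D w := W w - y (V w).
have myV : measurable_fun setT (y \o V) := intg_measurable (is_condexp_intg eW).
have mxV : measurable_fun setT (x \o V) := intg_measurable (is_condexp_intg eX).
have mD : measurable_fun setT D by exact: measurable_funB.
have Dc : {ae P, forall w, `|D w| <= c + c}.
  apply: filterS2 Wc yc => w h1 h2.
  by rewrite (le_trans (ler_normB _ _))// lerD.
have iD := intg_bounded mD Dc.
have iDX : intg P (fun w => D w * X w) by exact: intgMl mD iX Dc.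
have iDx : intg P (fun w => D w * x (V w)).
  exact: intgMl mD (is_condexp_intg eX) Dc.
have ixD : intg P (fun w => x (V w) * D w).
  by move: iDx; congr (integrable _ _ _); apply/funext => w /=; rewrite mulrC.
have eD : is_condexp P V D (cst 0).
  have := is_condexpB iW (is_condexp_intg eW) eW
    (is_condexp_comp (is_condexp_measurable eW) (is_condexp_intg eW)).
  by congr is_condexp; apply/funext => v /=; rewrite subrr.
have exD := is_condexp_mull iD (is_condexp_measurable eX) eD ixD.
have iXW : intg P (fun w => (X w - x (V w)) * D w).
  rewrite (_ : (fun w => _ * _) = fun w => D w * X w - x (V w) * D w).
    exact: intgB.
  by apply/funext => w; rewrite mulrBl [X w * _]mulrC.
have eC := condexpP iXW.
have := is_condexpD iXW ixD eC exD.
congr is_condexp.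
  by apply/funext => w; rewrite mulrBl subrK mulrC.
by apply/funext => w; rewrite /= mulr0 addr0.
Qed.

End condexp_theory.

Section tower.
Context {d d1 d2 : measure_display} {T : measurableType d}
  {T1 : measurableType d1} {T2 : measurableType d2} {R : realType}.
Variables (P : probability T R) (V : T -> T1) (phi : T1 -> T2).
Hypotheses (mphi : measurable_fun setT phi).

(** An event given by phi(V) is also given by [V], so replacing [X] by its conditional expectation
    changes no integral over it. With [snd] for [phi] this passes from (U, L) or (Z, L) to L. *)
Lemma is_condexp_tower X g k : is_condexp P V X g ->
  is_condexp P (phi \o V) X k -> is_condexp P (phi \o V) (g \o V) k.
Proof.
move=> [mg ig gE] [mk ik kE]; split => // B mB.
by rewrite kE// comp_preimage gE//; exact: measurable_preimage.
Qed.

End tower.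

(** * Conditional independence *)

Lemma integral_setI_indicM d (T : measurableType d) (R : realType)
  (P : {measure set T -> \bar R}) (A E : set T) (F : T -> R) :
  (\int[P]_(w in A `&` E) (F w)%:E = \int[P]_(w in A) (\1_E w * F w)%:E)%E.
Proof.
rewrite integral_mkcondr; apply: eq_integral => w _.
by rewrite patchE indicE; case: (w \in E); rewrite ?mul1r ?mul0r.
Qed.

Lemma indic_bound d (T : measurableType d) (R : realType)
  (P : {measure set T -> \bar R}) (E : set T) :
  {ae P, forall w, `|\1_E w : R| <= 1}.
Proof.
by apply: aeW => w; rewrite indicE; case: (w \in E); rewrite /= ?normr1 ?normr0.
Qed.

(** Rectangles are stable under intersection and generate the product sigma-algebra, so two finite
    measures that agree on them are equal. *)
Lemma same_weighted_law_rectangle {d1 d2 da db : measure_display}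
  {T1 : measurableType d1} {T2 : measurableType d2}
  {Ta : measurableType da} {Tb : measurableType db} {R : realType}
  (P1 : probability T1 R) (P2 : probability T2 R)
  (V1 : T1 -> Ta * Tb) (V2 : T2 -> Ta * Tb) (f1 : T1 -> R) (f2 : T2 -> R) :
  measurable_fun setT V1 -> measurable_fun setT V2 ->
  intg P1 f1 -> intg P2 f2 -> (forall w, 0 <= f1 w) -> (forall w, 0 <= f2 w) ->
  (forall B C, measurable B -> measurable C ->
    \int[P1]_(w in V1 @^-1` (B `*` C)) (f1 w)%:E =
    \int[P2]_(w in V2 @^-1` (B `*` C)) (f2 w)%:E)%E ->
  same_weighted_law P1 P2 V1 V2 f1 f2.
Proof.
move=> mV1 mV2 if1 if2 f10 f20 rect.
have [|nu1 [nu1E _]] := weighted_law mV1 if1; first by move=> w; rewrite lee_fin.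
have [|nu2 [nu2E _]] := weighted_law mV2 if2; first by move=> w; rewrite lee_fin.
pose G := [set A `*` B | A in (measurable : set (set Ta))
                       & B in (measurable : set (set Tb))].
move=> B mB; rewrite -[LHS]nu1E// -[RHS]nu2E//.
apply: (measure_unique G (fun=> setT)) => //.
- exact: measurable_prod_measurableType.
- move=> _ _ [A1 mA1 [A2 mA2 <-]] [B1 mB1 [B2 mB2 <-]].
  exists (A1 `&` B1); first exact: measurableI.
  by exists (A2 `&` B2); [exact: measurableI|rewrite setXI].
- by move=> _; exists setT => //; exists setT => //; rewrite setXTT.
- by rewrite bigcup_const//; exists 0%N.
- move=> _ [A mA [C mC <-]]; have mAC := measurableX mA mC.
  by etransitivity; [exact: nu1E|rewrite rect//; exact/esym/nu2E].
- by move=> _; rewrite ltey_eq fin_num_measure.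
Qed.

Section conditional_independence.
Context {d dz du dl : measure_display} {T : measurableType d} {R : realType}.
Context {TZ : measurableType dz} {TU : measurableType du}
  {TL : measurableType dl}.
Variables (P : probability T R) (Z : T -> TZ) (U : T -> TU) (L : T -> TL).
Hypotheses (mZ : measurable_fun setT Z) (mU : measurable_fun setT U)
  (mL : measurable_fun setT L).

Lemma cond_indep_sym : cond_indep P Z U L -> cond_indep P U Z L.
Proof.
move=> ZU B C mB mC; apply: filterS (ZU C B mC mB) => w.
by rewrite setIC mulrC.
Qed.

Hypothesis ZUL : cond_indep P Z U L.
Let ZL w := (Z w, L w).
Let UL w := (U w, L w).
Let mZL : measurable_fun setT ZL. Proof. exact: measurable_fun_pair. Qed.
Let mUL : measurable_fun setT UL. Proof. exact: measurable_fun_pair. Qed.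

Let mindic d1 (T1 : measurableType d1) (W : T -> T1) (B : set T1) :
  measurable_fun setT W -> measurable B ->
  measurable_fun setT (\1_(W @^-1` B) : T -> R).
Proof. by move=> mW mB; apply: measurable_indic; exact: measurable_preimage. Qed.

Let iindic d1 (T1 : measurableType d1) (W : T -> T1) (B : set T1) :
  measurable_fun setT W -> measurable B -> intg P (\1_(W @^-1` B)).
Proof.
move=> mW mB.
by apply: (@intg_bounded _ _ _ _ 1 (\1_(W @^-1` B))); [exact: mindic|exact: indic_bound].
Qed.

(** The indicator of the event U in B may be replaced by its conditional probability u(L) when
    integrating a function of (Z, L). On rectangles this is the product formula of conditional
    independence. *)
Lemma cond_indep_law_indic (B : set TU) (u : TL -> R) : measurable B ->
  is_condexp P L (\1_(U @^-1` B)) u -> (forall l, 0 <= u l) ->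
  same_weighted_law P P ZL ZL (\1_(U @^-1` B)) (u \o L).
Proof.
move=> mB eu u0; have [mu iu uE] := eu.
have u0' w : 0 <= (u \o L) w by exact: u0.
apply: same_weighted_law_rectangle => //; first exact: iindic.
move=> C D mC mD.
have mZC := measurable_preimage mZ mC; have mUB := measurable_preimage mU mB.
have mLD := measurable_preimage mL mD.
have -> : ZL @^-1` (C `*` D) = L @^-1` D `&` Z @^-1` C.
  by rewrite setIC; apply/seteqP; split => w [].
rewrite !integral_setI_indicM.
have iZC := iindic mZ mC; have eZC := condexpP mL iZC.
have iI : intg P (\1_(Z @^-1` C `&` U @^-1` B)).
  apply: (@intg_bounded _ _ _ _ 1 (\1_(Z @^-1` C `&` U @^-1` B))).
    by apply: measurable_indic; exact: measurableI.
  exact: indic_bound.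
have [mE iE EE] := condexpP mL iI.
have ub := is_condexp_bound mL (mindic mU mB) eu (indic_bound P _).
have muL : measurable_fun setT (u \o L) by exact: measurableT_comp.
have iu1 : intg P (fun w => u (L w) * \1_(Z @^-1` C) w).
  exact: (intgMl muL iZC ub).
have [mh ih hE] := is_condexp_mull mL iZC mu eZC iu1.
transitivity (\int[P]_(w in L @^-1` D) (\1_(Z @^-1` C `&` U @^-1` B) w)%:E)%E.
  by apply: eq_integral => w _; rewrite indicI.
rewrite -EE//.
transitivity (\int[P]_(w in L @^-1` D)
   (u (L w) * condexp P L (\1_(Z @^-1` C)) (L w))%:E)%E.
  apply: eq_integral_ae => //.
  - exact: measurableT_comp mE mL.
  - exact: measurableT_comp mh mL.
  have uu := is_condexp_uniq mL eu (condexpP mL (iindic mU mB)).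
  by apply: filterS2 (ZUL mC mB) uu => w -> ->; rewrite mulrC.
by rewrite hE//; apply: eq_integral => w _ /=; rewrite mulrC.
Qed.

(** Tested on the event U in B, L in D: the indicator of U in B is exchanged for u(L), then f(Z, L)
    for g(L) by conditioning on [L], and finally u(L) is exchanged back. *)
Lemma cond_indep_condexp_ge0 (f : TZ * TL -> R) (g : TL -> R) :
  measurable_fun setT f -> (forall x, 0 <= f x) -> intg P (f \o ZL) ->
  is_condexp P L (f \o ZL) g -> (forall l, 0 <= g l) ->
  is_condexp P UL (f \o ZL) (g \o snd).
Proof.
move=> mf f0 ifZL fg g0; have [mg ig gE] := fg.
have f0' w : 0 <= (f \o ZL) w by exact: f0.
have g0' w : 0 <= (g \o L) w by exact: g0.
suff swl : same_weighted_law P P UL UL (f \o ZL) (g \o L).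
  split => //; first exact: measurableT_comp.
  by move=> B mB; rewrite swl.
apply: same_weighted_law_rectangle => // B D mB mD.
have mUB := measurable_preimage mU mB; have mLD := measurable_preimage mL mD.
have -> : UL @^-1` (B `*` D) = L @^-1` D `&` U @^-1` B.
  by rewrite setIC; apply/seteqP; split => w [].
rewrite !integral_setI_indicM.
have iUB := iindic mU mB.
have [|u eu u0] := is_condexp_ge0_exists mL iUB; first by [].
have [mu iu uE] := eu.
have u0' w : 0 <= (u \o L) w by exact: u0.
have swl1 := cond_indep_law_indic mB eu u0.
have ub := is_condexp_bound mL (mindic mU mB) eu (indic_bound P _).
have muL : measurable_fun setT (u \o L) by exact: measurableT_comp.
transitivity (\int[P]_(w in L @^-1` D) (u (L w) * (f \o ZL) w)%:E)%E.
  transitivity (\int[P]_(w in ZL @^-1` (setT `*` D)) (f (ZL w) * \1_(U @^-1` B) w)%:E)%E.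
    have -> : ZL @^-1` (setT `*` D) = L @^-1` D by apply/seteqP; split => w // [].
    by apply: eq_integral => w _; rewrite mulrC.
  rewrite (transfer_set mZL mZL iUB iu _ u0' swl1)//; last exact: measurableX.
  have -> : ZL @^-1` (setT `*` D) = L @^-1` D by apply/seteqP; split => w // [].
  by apply: eq_integral => w _; rewrite mulrC.
have iuf : intg P (fun w => u (L w) * (f \o ZL) w) by exact: (intgMl muL ifZL ub).
have [_ _ <-//] := is_condexp_mull mL ifZL mu fg iuf.
have igu : intg P (fun w => g (L w) * \1_(U @^-1` B) w).
  have := intgMl (mindic mU mB) ig (indic_bound P (U @^-1` B)).
  by congr (integrable _ _ _); apply/funext => w /=; rewrite mulrC.
have [_ _ e] := is_condexp_mull mL iUB mg eu igu.
transitivity (\int[P]_(w in L @^-1` D) (g (L w) * u (L w))%:E)%E.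
  by apply: eq_integral => w _; rewrite mulrC.
by rewrite e//; apply: eq_integral => w _; rewrite /= mulrC.
Qed.

Lemma cond_indep_condexp (f : TZ * TL -> R) (g : TL -> R) :
  measurable_fun setT f -> intg P (f \o ZL) ->
  is_condexp P L (f \o ZL) g -> is_condexp P UL (f \o ZL) (g \o snd).
Proof.
move=> mf ifZL fg; have [mg _ _] := fg.
pose fp x := Num.max (f x) 0; pose fn x := Num.max (- f x) 0.
have mfp : measurable_fun setT fp by exact: measurable_funrpos.
have mfn : measurable_fun setT fn by exact: measurable_funrneg.
have ifp : intg P (fp \o ZL) by exact: (integrable_funrpos measurableT ifZL).
have ifn : intg P (fn \o ZL) by exact: (integrable_funrneg measurableT ifZL).
have fp0 x : 0 <= fp x by rewrite le_max lexx orbT.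
have fn0 x : 0 <= fn x by rewrite le_max lexx orbT.
have fE x : f x = fp x - fn x by rewrite /fp /fn maxr0B.
have [|gp gpE gp0] := is_condexp_ge0_exists mL ifp; first by move=> w; exact: fp0.
have [|gn gnE gn0] := is_condexp_ge0_exists mL ifn; first by move=> w; exact: fn0.
have hp := cond_indep_condexp_ge0 mfp fp0 ifp gpE gp0.
have hn := cond_indep_condexp_ge0 mfn fn0 ifn gnE gn0.
have := is_condexpB mUL ifp ifn hp hn.
rewrite (_ : (fun w => _ - _) = f \o ZL); last by apply/funext => w /=; rewrite fE.
have mgs : measurable_fun setT (g \o snd : TU * TL -> R) by exact: measurableT_comp.
apply: (is_condexp_ae_eq mUL mgs).
have := is_condexpB mL ifp ifn gpE gnE.
rewrite (_ : (fun w => _ - _) = f \o ZL); last by apply/funext => w /=; rewrite fE.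
by move=> /(is_condexp_uniq mL fg); apply: filterS => w /= ->.
Qed.

End conditional_independence.

(** * Conditioning on the treatment value *)

Section bayes.
Context {d d' : measure_display} {T : measurableType d} {T' : measurableType d'}
  {R : realType}.
Variables (P Q : probability T R) (c : R) (V : T -> T') (p : T' -> R).

(* [p / c] is the density of the law of [V] under [Q] with respect to its law
   under [P]; for [Q = P(. | A = a)] and [c = pA a] this is Bayes' rule *)
Definition bayes_density :=
  [/\ measurable_fun setT p, forall v, 0 <= p v &
      forall C, measurable C ->
        (c%:E * Q (V @^-1` C) = \int[P]_(w in V @^-1` C) (p (V w))%:E)%E].

Hypotheses (mV : measurable_fun setT V) (c0 : 0 <= c) (pB : bayes_density).

(** The total mass of p(V) under [P] is c, since [Q] has mass 1. *)
Lemma bayes_intg : intg P (p \o V).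
Proof.
have [mp p0 pE] := pB; apply/integrableP; split.
  by apply/measurable_EFinP; exact: measurableT_comp.
under eq_integral do rewrite /= ger0_norm//.
have := pE setT measurableT; rewrite preimage_setT => <-.
by rewrite probability_setT mule1 ltry.
Qed.

Lemma bayes_law : same_weighted_law Q P V V (cst c) (p \o V).
Proof.
have [mp p0 pE] := pB; move=> B mB; rewrite -[RHS]pE//.
by rewrite -(integral_cst Q (measurable_preimage mV mB)).
Qed.

Lemma bayes_transfer_set (f : T' -> R) (B : set T') :
  measurable_fun setT f -> measurable B ->
  (\int[Q]_(w in V @^-1` B) (f (V w) * c)%:E =
   \int[P]_(w in V @^-1` B) (f (V w) * p (V w))%:E)%E.
Proof.
have [mp p0 pE] := pB; move=> mf mB.
have p0' w : 0 <= (p \o V) w by exact: p0.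
exact: (transfer_set mV mV (intg_cst Q c) bayes_intg (fun=> c0) p0' bayes_law).
Qed.

Lemma bayes_transfer_intg (f : T' -> R) : measurable_fun setT f ->
  intg Q (f \o V) -> intg P (fun w => f (V w) * p (V w)).
Proof.
have [mp p0 pE] := pB; move=> mf ifQ.
have p0' w : 0 <= (p \o V) w by exact: p0.
apply: (transfer_integrable mV mV (intg_cst Q c) bayes_intg (fun=> c0) p0'
  bayes_law) => //.
exact: (integrableZr measurableT c ifQ).
Qed.

(** Over the event V in C, both p(V) E_Q[X | V] and [W] integrate under [P] to the integral of c X
    under [Q]. This is how a conditional expectation given A = a is read under [P]. *)
Lemma bayes_condexp (X W : T -> R) : intg Q X ->
  (forall C, measurable C ->
    \int[Q]_(w in V @^-1` C) (X w * c)%:E = \int[P]_(w in V @^-1` C) (W w)%:E)%E ->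
  is_condexp P V W (fun v => condexp Q V X v * p v).
Proof.
have [mp p0 pE] := pB; move=> iX XW.
have eX := condexpP mV iX; have [mk ik kE] := eX.
split; first exact: measurable_funM.
  exact: bayes_transfer_intg.
move=> C mC; rewrite -bayes_transfer_set// -XW//.
have icX : intg Q (fun w => (cst c \o V) w * X w) := integrableZl measurableT c iX.
have [_ _ e] := is_condexp_mull mV iX (@measurable_cst _ _ _ _ setT c) eX icX.
under eq_integral do rewrite mulrC.
by rewrite [LHS]e//; apply: eq_integral => w _; rewrite /= mulrC.
Qed.

End bayes.

(** * Latent ignorability under the law given A = a *)

Section ignorability.
Context {d dz du dl : measure_display} {T : measurableType d} {R : realType}.
Context {TZ : measurableType dz} {TU : measurableType du}
  {TL : measurableType dl}.
Variables (P Q : probability T R) (Z : T -> TZ) (U : T -> TU) (L : T -> TL).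
Variables (Ya : T -> R) (c : R) (p : TZ * TU * TL -> R).
Hypotheses (mZ : measurable_fun setT Z) (mU : measurable_fun setT U)
  (mL : measurable_fun setT L) (mYa : measurable_fun setT Ya).
Let ZUL w := (Z w, U w, L w).
Let UL w := (U w, L w).
Hypotheses (c0 : 0 <= c) (pB : bayes_density P Q c ZUL p).
Hypothesis ign : forall B : set R, measurable B ->
  {ae Q, forall w, condexp Q ZUL (\1_(Ya @^-1` B)) (ZUL w) =
                   condexp P UL (\1_(Ya @^-1` B)) (UL w)}.
Hypotheses (iYP : intg P Ya) (iYQ : intg Q Ya).
Let m := condexp P UL Ya.

Let mUL : measurable_fun setT UL. Proof. exact: measurable_fun_pair. Qed.
Let mZUL : measurable_fun setT ZUL.
Proof. by apply: measurable_fun_pair => //; exact: measurable_fun_pair. Qed.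

Let iindic (P0 : probability T R) (B : set R) : measurable B ->
  intg P0 (\1_(Ya @^-1` B)).
Proof.
move=> mB; apply: (@intg_bounded _ _ _ _ 1 (\1_(Ya @^-1` B))).
  by apply: measurable_indic; exact: measurable_preimage.
exact: indic_bound.
Qed.

(** Stated as an equality of weighted laws of Y(a): it is proved on events, where only indicators of
    Y(a) occur, and then extends to Y(a) itself by transfer. The weight [g] under [P] is
    E[h p | U, L]. *)
Lemma ignorability_law (h : TZ * TU * TL -> R) (k : R) (g : TU * TL -> R) :
  measurable_fun setT h -> (forall v, `|h v| <= k) ->
  is_condexp P UL (fun w => h (ZUL w) * p (ZUL w)) g ->
  same_weighted_law Q P Ya Ya (fun w => c * h (ZUL w)) (g \o UL).
Proof.
move=> mh hk eg B mB; have [mg ig gE] := eg; have [mp p0 pE] := pB.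
have ip := bayes_intg mZUL pB.
have mYB : measurable (Ya @^-1` B) by exact: measurable_preimage.
have mhZ : measurable_fun setT (h \o ZUL) by exact: measurableT_comp.
have ihp : intg P (fun w => h (ZUL w) * p (ZUL w)).
  by apply: (@intgMl _ _ _ P k (p \o ZUL) (h \o ZUL)) => //; apply: aeW => w; exact: hk.
have i1Q := iindic Q mB; have i1P := iindic P mB.
have eb := condexpP mZUL i1Q; have eb' := condexpP mUL i1P.
set b := condexp Q ZUL _ in eb; set b' := condexp P UL _ in eb'.
have [mb ib _] := eb; have [mb' ib' _] := eb'.
have b'1 : {ae P, forall w, `|b' (UL w)| <= 1}.
  exact: (is_condexp_bound mUL (intg_measurable i1P) eb' (indic_bound P _)).
rewrite -(setTI (Ya @^-1` B)) !integral_setI_indicM.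
(* Under [Q], the indicator is exchanged for its conditional probability given (Z, U, L). *)
transitivity (\int[Q]_w (c * h (ZUL w) * b (ZUL w))%:E)%E.
  have mch : measurable_fun setT (fun v => c * h v) by exact: measurable_funM.
  have ich : intg Q (fun w => c * h (ZUL w) * \1_(Ya @^-1` B) w).
    apply: (@intgMl _ _ _ Q (`|c| * k) (\1_(Ya @^-1` B)) (fun w => c * h (ZUL w))) => //.
      exact: measurableT_comp mch mZUL.
    by apply: aeW => w; rewrite normrM ler_wpM2l.
  rewrite [RHS](is_condexp_integral (is_condexp_mull mZUL i1Q mch eb ich)).
  by apply: eq_integral => w _; rewrite mulrC.
(* Ignorability identifies this probability with the one computed under [P], a function of (U,
   L). *)
transitivity (\int[Q]_w (b' (UL w) * h (ZUL w) * c)%:E)%E.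
  apply: eq_integral_ae => //.
  - apply: measurable_funM; last exact: measurableT_comp.
    by apply: measurable_funM => //; exact: measurableT_comp.
  - apply: measurable_funM => //; apply: measurable_funM => //.
    exact: measurableT_comp.
  have bb' : {ae Q, forall w, b (ZUL w) = b' (UL w)} := ign mB.
  by apply: filterS bb' => w ->; rewrite mulrC [c * _]mulrC mulrA.
pose F (v : TZ * TU * TL) := b' (v.1.2, v.2) * h v.
have mF : measurable_fun setT F.
  apply: measurable_funM => //; apply: measurableT_comp => //.
  apply: measurable_fun_pair => //.
  exact: (measurableT_comp measurable_snd measurable_fst).
(* Bayes' rule moves the integral from [Q] to [P]. *)
transitivity (\int[P]_w (F (ZUL w) * p (ZUL w))%:E)%E.
  by have := bayes_transfer_set mZUL c0 pB mF measurableT; rewrite preimage_setT.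
have ib'hp : intg P (fun w => b' (UL w) * (h (ZUL w) * p (ZUL w))).
  apply: (@intgMl _ _ _ P 1 _ (b' \o UL)) => //.
  exact: measurableT_comp.
have e1 := is_condexp_mull mUL ihp mb' eg ib'hp.
have ig1 : intg P (fun w => g (UL w) * \1_(Ya @^-1` B) w).
  have := @intgMl _ _ _ P 1 (g \o UL) (\1_(Ya @^-1` B)) (intg_measurable i1P) ig
    (indic_bound P _).
  by congr (integrable _ _ _); apply/funext => w /=; rewrite mulrC.
have e2 := is_condexp_mull mUL i1P mg eb' ig1.
transitivity (\int[P]_w (b' (UL w) * (h (ZUL w) * p (ZUL w)))%:E)%E.
  by apply: eq_integral => w _; rewrite /F mulrA.
(* Conditioning on (U, L) turns h p into [g]; once [g] is in place, [b'] goes back to the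
   indicator. *)
rewrite -(is_condexp_integral e1).
transitivity (\int[P]_w (g (UL w) * \1_(Ya @^-1` B) w)%:E)%E.
  rewrite -(is_condexp_integral e2).
  by apply: eq_integral => w _; rewrite mulrC.
by apply: eq_integral => w _; rewrite mulrC.
Qed.

Lemma ignorability_integral (h : TZ * TU * TL -> R) (k : R) :
  measurable_fun setT h -> (forall v, 0 <= h v <= k) ->
  intg P (fun w => m (UL w) * (h (ZUL w) * p (ZUL w))) /\
  (\int[Q]_w (Ya w * (c * h (ZUL w)))%:E =
   \int[P]_w (m (UL w) * (h (ZUL w) * p (ZUL w)))%:E)%E.
Proof.
move=> mh h0k; have [mp p0 pE] := pB.
have hk v : `|h v| <= k by have /andP[h0 hk] := h0k v; rewrite ger0_norm.
have ip := bayes_intg mZUL pB.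
have mhZ : measurable_fun setT (h \o ZUL) by exact: measurableT_comp.
have ihp : intg P (fun w => h (ZUL w) * p (ZUL w)).
  by apply: (@intgMl _ _ _ P k (p \o ZUL) (h \o ZUL)) => //; apply: aeW => w; exact: hk.
have hp0 w : 0 <= h (ZUL w) * p (ZUL w).
  by rewrite mulr_ge0//; have /andP[] := h0k (ZUL w).
have [g eg g0] := is_condexp_ge0_exists mUL ihp hp0.
have [mg ig _] := eg.
have swl := ignorability_law mh hk eg.
have em := condexpP mUL iYP; have [mm im _] := em.
have mch : measurable_fun setT (fun w => c * h (ZUL w)).
  exact: (measurable_funM (measurable_cst c) mhZ).
have ich : intg Q (fun w => c * h (ZUL w)).
  apply: (@intg_bounded _ _ _ _ (`|c| * k)) => //.
  by apply: aeW => w; rewrite normrM ler_wpM2l.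
have ch0 w : 0 <= c * h (ZUL w) by rewrite mulr_ge0//; have /andP[] := h0k (ZUL w).
have gU0 w : 0 <= (g \o UL) w by exact: g0.
have iYch : intg Q (fun w => id (Ya w) * (c * h (ZUL w))).
  have : intg Q (fun w => (c * h (ZUL w)) * Ya w).
    apply: (@intgMl _ _ _ Q (`|c| * k)) => //.
    by apply: aeW => w; rewrite normrM ler_wpM2l.
  by congr (integrable _ _ _); apply/funext => w /=; rewrite mulrC.
have mid : measurable_fun setT (@id R) by [].
(* Nothing bounds Y(a), so integrability of m h p is derived from that of Y(a) under [Q]: it passes
   to g Y(a) under [P], then to m g by conditioning on (U, L), and from [g] back to h p.
   Nonnegativity of [h] makes both weights admissible. *)
have iYg := transfer_integrable mYa mYa ich ig ch0 gU0 swl mid iYch.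
have igY : intg P (fun w => g (UL w) * Ya w).
  by move: iYg; congr (integrable _ _ _); apply/funext => w /=; rewrite mulrC.
have e1 := is_condexp_mull mUL iYP mg em igY.
have img : intg P (fun w => m (UL w) * g (UL w)).
  have := is_condexp_intg e1; congr (integrable _ _ _).
  by apply/funext => w /=; rewrite mulrC.
have imhp := intg_mull_condexp mUL ihp hp0 mm eg img.
split => //.
have e2 := is_condexp_mull mUL ihp mm eg imhp.
rewrite -(is_condexp_integral e2).
rewrite (transfer mYa mYa ich ig ch0 gU0 swl mid).
transitivity (\int[P]_w (g (UL w) * Ya w)%:E)%E.
  by apply: eq_integral => w _; rewrite /= mulrC.
rewrite -(is_condexp_integral e1).
by apply: eq_integral => w _; rewrite /= mulrC.
Qed.

Lemma ge0_ignorability_integral_set (h : TZ * TU * TL -> R) (k : R) (C : set TL) :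
  measurable_fun setT h -> (forall v, 0 <= h v <= k) -> measurable C ->
  (\int[Q]_(w in L @^-1` C) (Ya w * h (ZUL w) * c)%:E =
   \int[P]_(w in L @^-1` C) (m (UL w) * (h (ZUL w) * p (ZUL w)))%:E)%E.
Proof.
move=> mh h0k mC; pose hC (v : TZ * TU * TL) := h v * \1_C v.2.
have mhC : measurable_fun setT hC.
  have m1C : measurable_fun setT (\1_C : TL -> R) by exact: measurable_indic.
  by apply: measurable_funM => //; exact: (measurableT_comp m1C measurable_snd).
have hC0k v : 0 <= hC v <= k.
  rewrite /hC indicE; have /andP[h0 hk] := h0k v.
  case: (v.2 \in C); rewrite ?mulr1 ?mulr0 ?h0//= lexx/=.
  exact: le_trans hk.
have [_] := ignorability_integral mhC hC0k.
rewrite -(setTI (L @^-1` C)) !integral_setI_indicM /hC => e.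
transitivity (\int[Q]_w (Ya w * (c * (h (ZUL w) * \1_C (ZUL w).2)))%:E)%E.
  apply: eq_integral => w _; congr EFin.
  by rewrite -[\1_C _]/(\1_(L @^-1` C) w); ring.
rewrite e; apply: eq_integral => w _; congr EFin.
by rewrite -[\1_C _]/(\1_(L @^-1` C) w); ring.
Qed.

Lemma ignorability_integral_set (h : TZ * TU * TL -> R) (k : R) (C : set TL) :
  measurable_fun setT h -> (forall v, `|h v| <= k) -> measurable C ->
  intg P (fun w => m (UL w) * (h (ZUL w) * p (ZUL w))) /\
  (\int[Q]_(w in L @^-1` C) (Ya w * h (ZUL w) * c)%:E =
   \int[P]_(w in L @^-1` C) (m (UL w) * (h (ZUL w) * p (ZUL w)))%:E)%E.
Proof.
move=> mh hk mC.
(* The value of [h] at the default element of its domain shows that [k] is nonnegative. *)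
have k0 : 0 <= k by exact: le_trans (hk point).
have hkE v : - k <= h v <= k by rewrite -ler_norml.
(* The nonnegative case applies to h + k and to the constant k, whose difference is [h]. *)
pose h1 v := h v + k; pose h2 (v : TZ * TU * TL) := k.
have mh1 : measurable_fun setT h1 by exact: measurable_funD.
have mh2 : measurable_fun setT h2 by exact: measurable_cst.
have h10 v : 0 <= h1 v <= k + k.
  by have /andP[h3 h4] := hkE v; rewrite /h1 -lerBlDr sub0r h3 lerD2r.
have h20 v : 0 <= h2 v <= k by rewrite /h2 k0 lexx.
have [i1 _] := ignorability_integral mh1 h10.
have [i2 _] := ignorability_integral mh2 h20.
have e1 := ge0_ignorability_integral_set mh1 h10 mC.
have e2 := ge0_ignorability_integral_set mh2 h20 mC.
have E w : m (UL w) * (h (ZUL w) * p (ZUL w)) =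
    m (UL w) * (h1 (ZUL w) * p (ZUL w)) - m (UL w) * (h2 (ZUL w) * p (ZUL w)).
  by rewrite /h1 /h2; ring.
have E' w : Ya w * h (ZUL w) * c =
    Ya w * h1 (ZUL w) * c - Ya w * h2 (ZUL w) * c.
  by rewrite /h1 /h2; ring.
have mLC := measurable_preimage mL mC.
have iQ (h' : TZ * TU * TL -> R) (k' : R) :
    measurable_fun setT h' -> (forall v, 0 <= h' v <= k') ->
    intg Q (fun w => Ya w * h' (ZUL w) * c).
  move=> mh' h'k.
  rewrite (_ : (fun w => _) = fun w => c * h' (ZUL w) * Ya w); last first.
    by apply/funext => w; ring.
  apply: (@intgMl _ _ _ Q (`|c| * k') Ya (fun w => c * h' (ZUL w))) => //.
    by apply: measurable_funM => //; exact: measurableT_comp mh' mZUL.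
  apply: aeW => w; rewrite normrM ler_wpM2l//.
  by have /andP[h0 hk'] := h'k (ZUL w); rewrite ger0_norm.
split.
  by rewrite (funext E); exact: (intgB i1 i2).
under [RHS]eq_integral do rewrite E.
under [LHS]eq_integral do rewrite E'.
rewrite !integralB_EFin// ?e1 ?e2//.
- exact: (integrableS measurableT mLC (@subsetT _ _) i1).
- exact: (integrableS measurableT mLC (@subsetT _ _) i2).
- exact: (integrableS measurableT mLC (@subsetT _ _) (iQ _ _ mh1 h10)).
- exact: (integrableS measurableT mLC (@subsetT _ _) (iQ _ _ mh2 h20)).
Qed.

End ignorability.

(** Inversion is continuous off 0, and on the singleton of 0 measurability is immediate. *)
Lemma measurable_invr (R : realType) : measurable_fun setT (@GRing.inv R).
Proof.
rewrite -(setvU [set 0]); apply/measurable_funU => //.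
  exact: measurableC.
split; last exact: measurable_fun_set1.
apply: open_continuous_measurable_fun => [|x].
  by apply: closed_openC; exact: closed_eq.
by rewrite inE => /eqP; exact: inv_continuous.
Qed.

(** * The weighted estimand and the three formulas, with [Q] for the law given A = a *)

Section weighting.
Context {d dz du dl : measure_display} {T : measurableType d} {R : realType}.
Context {TZ : measurableType dz} {TU : measurableType du}
  {TL : measurableType dl}.
Variables (P Q : probability T R) (Z : T -> TZ) (U : T -> TU) (L : T -> TL).
Variables (Y Ya : T -> R) (c : R).
Variables (pZUL : TZ * TU * TL -> R) (pZL : TZ * TL -> R) (pL : TL -> R).
Variable pi : TZ * TL -> R.
Hypotheses (mZ : measurable_fun setT Z) (mU : measurable_fun setT U)
  (mL : measurable_fun setT L) (mY : measurable_fun setT Y)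
  (mYa : measurable_fun setT Ya) (mpi : measurable_fun setT pi).
Let ZUL w := (Z w, U w, L w).
Let ZL w := (Z w, L w).
Let UL w := (U w, L w).
Hypotheses (c0 : 0 <= c) (ZULB : bayes_density P Q c ZUL pZUL)
  (ZLB : bayes_density P Q c ZL pZL) (LB : bayes_density P Q c L pL).
Hypothesis ign : forall B : set R, measurable B ->
  {ae Q, forall w, condexp Q ZUL (\1_(Ya @^-1` B)) (ZUL w) =
                   condexp P UL (\1_(Ya @^-1` B)) (UL w)}.
Hypotheses (iYP : intg P Ya) (iYQ : intg Q Y) (YE : {ae Q, forall w, Y w = Ya w}).
Hypothesis (ZU : cond_indep P Z U L).
Variables (M e1 e2 k : R).
Hypotheses (pM : {ae P, forall w, pZL (ZL w) <= M}) (e10 : 0 < e1) (e20 : 0 < e2)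
  (pe1 : {ae P, forall w, e1 <= pL (L w)}) (pik : forall x, `|pi x| <= k).
Let Zp w := pi (ZL w).
Let zeta := condexp P L Zp.
Hypothesis kape2 :
  {ae P, forall w, e2 <= `|condexp Q L Zp (L w) - zeta (L w)|}.

Let p w := pZUL (ZUL w).
Let m := condexp P UL Ya.
Let Zc w := Zp w - zeta (L w).
Let D := condcov P L p Zp.
Let n := condcov P UL p Zp.
Let om ul := n ul / D ul.2.
Let num l := condexp Q L (fun w => Y w * Zp w) l - condexp Q L Y l * zeta l.
Let mu l := num l / (condexp Q L Zp l - zeta l).

Let mUL : measurable_fun setT UL. Proof. exact: measurable_fun_pair. Qed.
Let mZL : measurable_fun setT ZL. Proof. exact: measurable_fun_pair. Qed.
Let mZUL : measurable_fun setT ZUL.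
Proof. by apply: measurable_fun_pair => //; exact: measurable_fun_pair. Qed.
Let mZp : measurable_fun setT Zp. Proof. exact: measurableT_comp. Qed.
Let Zpk (P0 : probability T R) : {ae P0, forall w, `|Zp w| <= k}.
Proof. by apply: aeW => w; exact: pik. Qed.
Let iZp (P0 : probability T R) : intg P0 Zp.
Proof. exact: (intg_bounded mZp (Zpk P0)). Qed.
Let ip : intg P p. Proof. exact: bayes_intg mZUL ZULB. Qed.
Let mp : measurable_fun setT p. Proof. exact: intg_measurable ip. Qed.
Let p0 w : 0 <= p w. Proof. by have [_ + _] := ZULB; exact. Qed.
Let ezeta : is_condexp P L Zp zeta. Proof. exact: condexpP. Qed.
Let mzeta : measurable_fun setT zeta. Proof. by have [] := ezeta. Qed.
Let mzetaL : measurable_fun setT (zeta \o L). Proof. exact: measurableT_comp. Qed.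
Let zetak : {ae P, forall w, `|(zeta \o L) w| <= k}.
Proof. exact: is_condexp_bound mZp ezeta (Zpk P). Qed.
Let mZc : measurable_fun setT Zc. Proof. exact: measurable_funB. Qed.
Let Zck : {ae P, forall w, `|Zc w| <= k + k}.
Proof.
apply: filterS2 (Zpk P) zetak => w h1 h2.
by rewrite (le_trans (ler_normB _ _))// lerD.
Qed.
Let iZcp : intg P (fun w => Zc w * p w). Proof. exact: intgMl mZc ip Zck. Qed.
Let em : is_condexp P UL Ya m. Proof. exact: condexpP. Qed.
Let mm : measurable_fun setT m. Proof. by have [] := em. Qed.
Let mmUL : measurable_fun setT (m \o UL). Proof. exact: measurableT_comp. Qed.
Let mpL : measurable_fun setT pL. Proof. by have [] := LB. Qed.

(** Bayes' rule for (Z, U, L), read on events that depend on [L] only, and Bayes' rule for [L] both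
    compute c Q(L in C). *)
Let ep : is_condexp P L p pL.
Proof.
have [_ _ ZULE] := ZULB; have [_ _ LE] := LB; split => //.
  exact: bayes_intg mL LB.
move=> C mC; rewrite -LE//.
have mC' : measurable (@snd (TZ * TU) TL @^-1` C).
  by apply: measurable_preimage => //.
by rewrite -[RHS](ZULE _ mC').
Qed.

Let epZL : is_condexp P ZL p pZL.
Proof.
have [mpZL _ ZLE] := ZLB; have [_ _ ZULE] := ZULB; split => //.
  exact: bayes_intg mZL ZLB.
move=> C mC; rewrite -ZLE//.
pose f (v : TZ * TU * TL) := (v.1.1, v.2).
have mf : measurable_fun setT f.
  apply: measurable_fun_pair => //.
  exact: (measurableT_comp measurable_fst measurable_fst).
by rewrite -[RHS](ZULE _ (measurable_preimage mf mC)).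
Qed.

(** By the tower property pL(L) is the mean of pZL(Z, L) given [L], so it inherits the bound [M]. *)
Let pLM : {ae P, forall w, pL (L w) <= M}.
Proof.
have epL : is_condexp P L (pZL \o ZL) pL.
  by apply: (is_condexp_tower (phi := snd) measurable_snd epZL); exact: ep.
apply: (is_condexp_le mL (is_condexp_intg epZL) (intg_cst P M) epL) => //.
exact: is_condexp_cst.
Qed.

Let eZpp : is_condexp P L (fun w => Zp w * p w) (fun l => condexp Q L Zp l * pL l).
Proof.
apply: (bayes_condexp mL c0 LB (iZp Q)) => C mC.
pose f (v : TZ * TU * TL) := pi (v.1.1, v.2).
have mf : measurable_fun setT f.
  apply: measurableT_comp => //; apply: measurable_fun_pair => //.
  exact: (measurableT_comp measurable_fst measurable_fst).
have mC' : measurable (@snd (TZ * TU) TL @^-1` C).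
  by apply: measurable_preimage => //.
exact: (bayes_transfer_set mZUL c0 ZULB mf mC').
Qed.

Let izp : intg P (fun w => zeta (L w) * p w).
Proof. exact: (intgMl mzetaL ip zetak). Qed.

Let eD : is_condexp P L (fun w => Zc w * p w) D.
Proof. by have := condcovP mL ip mZp (Zpk P); exact. Qed.

(** The denominator of omega is the RWF contrast times the density of the treatment given [L]; lower
    bounds on these two factors keep it away from 0. *)
Let DE : {ae P, forall w, D (L w) = (condexp Q L Zp (L w) - zeta (L w)) * pL (L w)}.
Proof.
have iZpp : intg P (fun w => Zp w * p w) by exact: intgMl mZp ip (Zpk P).
have := is_condexpB mL iZpp izp eZpp (is_condexp_mull mL ip mzeta ep izp).
rewrite (_ : (fun w => _ - _) = fun w => Zc w * p w); last first.
  by apply/funext => w; rewrite -mulrBl.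
move=> /(is_condexp_uniq mL eD); apply: filterS => w ->.
by rewrite mulrBl.
Qed.

Let D_lb : {ae P, forall w, e2 * e1 <= `|D (L w)|}.
Proof.
apply: filterS3 DE kape2 pe1 => w -> h2 h1.
have pL0 : 0 <= pL (L w) by exact: le_trans (ltW e10) h1.
by rewrite normrM [`|pL _|]ger0_norm// ler_pM// ltW.
Qed.

Let D_neq0 : {ae P, forall w, D (L w) != 0}.
Proof.
apply: filterS D_lb => w h; rewrite -normr_gt0; apply: lt_le_trans h.
by rewrite mulr_gt0.
Qed.

(** By definition [n] centers pi(Z, L) at its mean given (U, L); IV independence makes that mean
    zeta(L), so the same [Zc] serves for [n] and [D]. *)
Let en : is_condexp P UL (fun w => Zc w * p w) n.
Proof.
have e := condcovP mUL ip mZp (Zpk P).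
have z1 := condexpP mUL (iZp P).
have z2 := cond_indep_condexp mZ mU mL ZU mpi (iZp P) ezeta.
have z12 := is_condexp_uniq mUL z1 z2.
apply: (is_condexp_ae_eq_arg mUL _ _ _ e).
- apply: measurable_funM => //; apply: measurable_funB => //.
  by apply: measurableT_comp => //; case: z1.
- exact: measurable_funM.
- by apply: filterS z12 => w ->.
Qed.

Let mD : measurable_fun setT D. Proof. by have [] := eD. Qed.
Let mDi : measurable_fun setT (fun l => (D l)^-1).
Proof. exact: (measurableT_comp (@measurable_invr R) mD). Qed.


(** Ignorability and Bayes' rule combined. The case h = 1 gives E_Q[Y | L], and the case h = pi
    gives E_Q[Y pi | L]. *)
Let ign_condexp (h : TZ * TU * TL -> R) (k' : R) :
  measurable_fun setT h -> (forall v, `|h v| <= k') ->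
  intg P (fun w => m (UL w) * (h (ZUL w) * p w)) /\
  is_condexp P L (fun w => m (UL w) * (h (ZUL w) * p w))
    (fun l => condexp Q L (fun w => Y w * h (ZUL w)) l * pL l).
Proof.
move=> mh hk'.
have YaE : {ae Q, forall w, Ya w = Y w} by apply: filterS YE.
have iYaQ : intg Q Ya by exact: intg_ae iYQ YaE.
have mhZ : measurable_fun setT (h \o ZUL) by exact: measurableT_comp.
have iYh : intg Q (fun w => Y w * h (ZUL w)).
  rewrite (_ : (fun w => _) = fun w => h (ZUL w) * Y w).
    by apply: (@intgMl _ _ _ Q k' Y (h \o ZUL)) => //; apply: aeW => w; exact: hk'.
  by apply/funext => w; rewrite mulrC.
have ii C := @ignorability_integral_set _ _ _ _ _ _ _ _ _ P Q Z U L Ya c pZUL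
  mZ mU mL mYa c0 ZULB ign iYP iYaQ h k' C mh hk'.
have [imh _] := ii setT measurableT; split => //.
apply: (bayes_condexp mL c0 LB iYh) => C mC.
have [_ <-] := ii C mC.
apply: eq_integral_ae => //.
- exact: measurable_preimage.
- by apply: measurable_funM => //; exact: measurable_funM.
- by apply: measurable_funM => //; exact: measurable_funM.
- by apply: filterS YE => w ->.
Qed.

Let imp : intg P (fun w => m (UL w) * p w).
Proof.
have [|i _] := @ign_condexp (cst 1) 1 (measurable_cst _).
  by move=> v; rewrite normr1.
by move: i; congr (integrable _ _ _); apply/funext => w /=; rewrite mul1r.
Qed.

Let emp : is_condexp P L (fun w => m (UL w) * p w) (fun l => condexp Q L Y l * pL l).
Proof.
have [|_] := @ign_condexp (cst 1) 1 (measurable_cst _).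
  by move=> v; rewrite normr1.
congr is_condexp; first by apply/funext => w /=; rewrite mul1r.
apply/funext => l; congr (condexp _ _ _ _ * _).
by apply/funext => w /=; rewrite mulr1.
Qed.

Let imZcp : intg P (fun w => m (UL w) * (Zc w * p w)).
Proof.
rewrite (_ : (fun w => _) = fun w => Zc w * (m (UL w) * p w)).
  exact: intgMl mZc imp Zck.
by apply/funext => w; ring.
Qed.

(** The case h = pi minus zeta(L) times the case h = 1 assembles the centered factor [Zc]. *)
Let eN : is_condexp P L (fun w => m (UL w) * (Zc w * p w)) (fun l => num l * pL l).
Proof.
pose h (v : TZ * TU * TL) := pi (v.1.1, v.2).
have mh : measurable_fun setT h.
  apply: measurableT_comp => //; apply: measurable_fun_pair => //.
  exact: (measurableT_comp measurable_fst measurable_fst).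
have [|i1 e1'] := @ign_condexp h k mh; first by move=> v; exact: pik.
have i2 : intg P (fun w => zeta (L w) * (m (UL w) * p w)).
  exact: (intgMl mzetaL imp zetak).
have e2' := is_condexp_mull mL imp mzeta emp i2.
have := is_condexpB mL i1 i2 e1' e2'; congr is_condexp.
  by apply/funext => w; rewrite /Zc /Zp /h /=; ring.
by apply/funext => l; rewrite /num /Zp /h /=; ring.
Qed.

(** The variable behind the first formula: its mean given [L] is mu(L) and its mean given (U, L) is
    m om, so these two have the same expectation. *)
Let X w := (D (L w))^-1 * (m (UL w) * (Zc w * p w)).

Let DiL_bound : {ae P, forall w, `|(D (L w))^-1| <= (e2 * e1)^-1}.
Proof.
apply: filterS D_lb => w h; rewrite normfV lef_pV2// posrE ?mulr_gt0//.
by apply: lt_le_trans h; rewrite mulr_gt0.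
Qed.

Let mDiL : measurable_fun setT (fun w => (D (L w))^-1).
Proof. exact: (measurableT_comp mDi mL). Qed.

Let iX : intg P X.
Proof. exact: (intgMl mDiL imZcp DiL_bound). Qed.

Let mnum : measurable_fun setT num.
Proof.
apply: measurable_funB; first exact: condexp_measurable.
by apply: measurable_funM => //; exact: condexp_measurable.
Qed.

Let mmu : measurable_fun setT mu.
Proof.
apply: measurable_funM => //; apply: (measurableT_comp (@measurable_invr R)).
by apply: measurable_funB => //; exact: condexp_measurable.
Qed.

Lemma mu_condexp : is_condexp P L X mu.
Proof.
have := is_condexp_mull mL imZcp mDi eN iX.
apply: (is_condexp_ae_eq mL mmu).
(* Since [D] is the RWF contrast times [pL], the nonzero factor [pL] cancels in num pL / D and [mu]
   remains. *)
apply: filterS3 DE D_neq0 pe1 => w DE' D0 pe.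
move: D0; rewrite DE' /mu mulf_eq0 negb_or => /andP[kap0 pL0].
by rewrite invfM; field; rewrite kap0.
Qed.

Lemma m_om_condexp : is_condexp P UL X (fun ul => m ul * om ul).
Proof.
pose h (ul : TU * TL) := (D ul.2)^-1 * m ul.
have mh : measurable_fun setT h.
  by apply: measurable_funM => //; exact: (measurableT_comp mDi measurable_snd).
have XE : X = fun w => h (UL w) * (Zc w * p w).
  by apply/funext => w; rewrite /X /h /=; ring.
have := iX; rewrite XE => /(is_condexp_mull mUL iZcp mh en).
by congr is_condexp; apply/funext => ul; rewrite /om /h; ring.
Qed.

Lemma integral_mu_o : (\int[P]_w (mu (L w))%:E = \int[P]_w (m (UL w) * om (UL w))%:E)%E.
Proof.
by rewrite (is_condexp_integral mu_condexp) -(is_condexp_integral m_om_condexp).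
Qed.


(** The analogue of [X] without [m]: its mean given (U, L) is [om] and its mean given [L] is 1,
    whence E[om | L] = 1. *)
Let W w := (D (L w))^-1 * (Zc w * p w).

Let iW : intg P W. Proof. exact: (intgMl mDiL iZcp DiL_bound). Qed.

Let omE ul : om ul = (D ul.2)^-1 * n ul. Proof. exact: mulrC. Qed.

Lemma om_condexp : is_condexp P UL W om.
Proof.
have mh : measurable_fun setT (fun ul : TU * TL => (D ul.2)^-1).
  exact: (measurableT_comp mDi measurable_snd).
have := is_condexp_mull mUL iZcp mh en iW.
by congr is_condexp; apply/funext => ul; rewrite omE.
Qed.

Let W1 : is_condexp P L W (cst 1).
Proof.
apply: (is_condexp_ae_eq mL _ _ (is_condexp_mull mL iZcp mDi eD iW)) => //.
by apply: filterS D_neq0 => w D0; rewrite mulVf.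
Qed.

Let iom : intg P (fun w => om (UL w)). Proof. exact: is_condexp_intg om_condexp. Qed.

Let om1 : is_condexp P L (om \o UL) (cst 1).
Proof. exact: (is_condexp_tower (phi := snd) measurable_snd om_condexp W1). Qed.

Let imUL : intg P (fun w => m (UL w)). Proof. exact: is_condexp_intg em. Qed.

(** Write mL' for E[m | L]. As E[om | L] = 1, the covariance integrates to E[m om] - E[mL' om] -
    E[m] + E[mL']. The last two terms cancel, and E[mL' om] = E[mL'] = E[Y(a)]. *)
Lemma integral_condcov_m_om :
  (\int[P]_w (condcov P L (fun w => m (UL w)) (fun w => om (UL w)) (L w))%:E =
   \int[P]_w (mu (L w))%:E - \int[P]_w (Ya w)%:E)%E.
Proof.
have emL := condexpP mL imUL; have eoL := condexpP mL iom.
set mL' := condexp P L (fun w => m (UL w)) in emL.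
set oL := condexp P L (fun w => om (UL w)) in eoL.
have [mmL imL _] := emL; have [moL ioL _] := eoL.
have mmLL : measurable_fun setT (fun w => mL' (L w)) by exact: (measurableT_comp mmL mL).
have moLL : measurable_fun setT (fun w => oL (L w)) by exact: (measurableT_comp moL mL).
have momUL : measurable_fun setT (fun w => om (UL w)) := intg_measurable iom.
have oL1 : {ae P, forall w, oL (L w) = 1} := is_condexp_uniq mL eoL om1.
(* Integrability comes from E[p | L] = pL(L) being bounded by [M]. *)
have imLp : intg P (fun w => mL' (L w) * p w).
  apply: (intg_mull_condexp mL ip p0 mmL ep).
  rewrite (_ : (fun w => _) = fun w => pL (L w) * mL' (L w)); last first.
    by apply/funext => w; rewrite mulrC.
  apply: (@intgMl _ _ _ P M (fun w => mL' (L w)) (fun w => pL (L w))) => //.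
    exact: (measurableT_comp mpL mL).
  apply: filterS pLM => w; rewrite ger0_norm//.
  by have [_ + _] := LB; exact.
have imLW : intg P (fun w => mL' (L w) * W w).
  have i1 : intg P (fun w => Zc w * (mL' (L w) * p w)) by exact: intgMl mZc imLp Zck.
  rewrite (_ : (fun w => _) = fun w => (D (L w))^-1 * (Zc w * (mL' (L w) * p w))).
    exact: (intgMl mDiL i1 DiL_bound).
  by apply/funext => w; rewrite /W; ring.
have mmLs : measurable_fun setT (fun ul : TU * TL => mL' ul.2).
  exact: (measurableT_comp mmL measurable_snd).
have eUL := is_condexp_mull mUL iW mmLs om_condexp imLW.
have eL := is_condexp_mull mL iW mmL W1 imLW.
have imLom : intg P (fun w => mL' (L w) * om (UL w)) := is_condexp_intg eUL.
have intmL : (\int[P]_w (mL' (L w))%:E = \int[P]_w (Ya w)%:E)%E.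
  by rewrite (is_condexp_integral emL) (is_condexp_integral em).
have intmLom : (\int[P]_w (mL' (L w) * om (UL w))%:E = \int[P]_w (Ya w)%:E)%E.
  rewrite (is_condexp_integral eUL) -(is_condexp_integral eL) -intmL.
  by apply: eq_integral => w _; rewrite mulr1.
have imom : intg P (fun w => m (UL w) * om (UL w)) := is_condexp_intg m_om_condexp.
pose F w := (m (UL w) - mL' (L w)) * (om (UL w) - oL (L w)).
pose G w := (m (UL w) * om (UL w) - mL' (L w) * om (UL w)) - (m (UL w) - mL' (L w)).
have FG : {ae P, forall w, F w = G w}.
  by apply: filterS oL1 => w; rewrite /F /G => ->; ring.
have i1 := intgB imom imLom; have i2 := intgB imUL imL.
have iG : intg P G by exact: intgB.
have mF : measurable_fun setT F by apply: measurable_funM; exact: measurable_funB.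
have iF : intg P F by exact: intg_ae iG FG.
rewrite (is_condexp_integral (condexpP mL iF)).
rewrite (eq_integral_ae measurableT mF (intg_measurable iG) FG).
rewrite integralB_EFin// integralB_EFin// integralB_EFin//.
rewrite intmLom intmL -integral_mu_o (is_condexp_integral em) subee ?sube0//.
exact: integrable_fin_num.
Qed.

(** Here omega = 1 almost surely. Multiplied by a positive phiL(L), the density splits into
    integrable parts h(U, L) + f(Z, L); against [Zc] the first has mean 0 given (U, L), and the
    second has a mean that depends on [L] only. *)
Lemma AIV_integral_mu_o : (exists (b : TU * TL -> R) (cc : TZ * TL -> R),
    [/\ measurable_fun setT b, measurable_fun setT cc &
        {ae P, forall w, p w = b (UL w) + cc (ZL w)}]) ->
  (\int[P]_w (Ya w)%:E = \int[P]_w (mu (L w))%:E)%E.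
Proof.
move=> [b [cc [mb mcc pE]]].
(* Neither [b] nor [cc] needs to be integrable: after multiplication by a
   positive function of [L] both become so. *)
pose phi ul := (1 + `|b ul|)^-1.
have phi0 ul : 0 < phi ul by rewrite invr_gt0 ltr_pwDl.
have phi1 ul : phi ul <= 1 by rewrite invf_le1 ?ltr_pwDl// lerDl.
have phib ul : `|phi ul * b ul| <= 1.
  rewrite normrM gtr0_norm// mulrC ler_pdivrMr ?ltr_pwDl//.
  by rewrite mul1r lerDr.
have mphi : measurable_fun setT phi.
  apply: (measurableT_comp (@measurable_invr R)).
  by apply: measurable_funD => //; exact: measurableT_comp.
have mphiUL : measurable_fun setT (phi \o UL) by exact: measurableT_comp.
have mbUL : measurable_fun setT (b \o UL) by exact: measurableT_comp.
have mccZL : measurable_fun setT (cc \o ZL) by exact: measurableT_comp.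
have phiB : {ae P, forall w, `|(phi \o UL) w| <= 1}.
  by apply: aeW => w; rewrite /= (gtr0_norm (phi0 _)) phi1.
have iphi : intg P (phi \o UL) by exact: (intg_bounded mphiUL phiB).
have ephi := condexpP mL iphi; set phiL := condexp P L _ in ephi.
have [mphiL iphiL _] := ephi.
have mphiLL : measurable_fun setT (phiL \o L) by exact: measurableT_comp.
have phiL0 := is_condexp_gt0 mL iphi (fun w => phi0 (UL w)) ephi.
have phiL1 := is_condexp_bound mL mphiUL ephi phiB.
(* Independence with [U] and [Z] exchanged: given (Z, L), the mean of phi(U, L) is phiL(L). *)
have ephiZL := cond_indep_condexp mU mZ mL (cond_indep_sym ZU) mphi iphi ephi.
(* Almost surely cc phi = phi p - phi b, and both terms are integrable; taking the mean given (Z, L)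
   then makes cc phiL integrable. *)
have iccphi : intg P (fun w => cc (ZL w) * (phi \o UL) w).
  have i1 : intg P (fun w => phi (UL w) * p w) by exact: (intgMl mphiUL ip phiB).
  have i2 : intg P (fun w => phi (UL w) * b (UL w)).
    apply: (@intg_bounded _ _ _ _ 1); first exact: measurable_funM.
    by apply: aeW => w; exact: phib.
  apply: (intg_ae _ (intgB i1 i2)); first exact: measurable_funM.
  by apply: filterS pE => w ->; rewrite /=; ring.
pose f (zl : TZ * TL) := cc zl * phiL zl.2.
have mf : measurable_fun setT f.
  by apply: measurable_funM => //; exact: (measurableT_comp mphiL measurable_snd).
have if_ : intg P (f \o ZL).
  exact: is_condexp_intg (is_condexp_mull mZL iphi mcc ephiZL iccphi).
pose h (ul : TU * TL) := phiL ul.2 * b ul.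
have mh : measurable_fun setT h.
  by apply: measurable_funM => //; exact: (measurableT_comp mphiL measurable_snd).
have ih : intg P (h \o UL).
  have i1 : intg P (fun w => phiL (L w) * p w) by exact: (intgMl mphiLL ip phiL1).
  apply: (intg_ae _ (intgB i1 if_)); first exact: measurableT_comp.
  by apply: filterS pE => w ->; rewrite /h /f /=; ring.
have eZc0 : is_condexp P UL Zc (cst 0).
  have mzs : measurable_fun setT (fun ul : TU * TL => zeta ul.2).
    exact: (measurableT_comp mzeta measurable_snd).
  have z2 := cond_indep_condexp mZ mU mL ZU mpi (iZp P) ezeta.
  have iz : intg P (fun w => zeta (L w)) := is_condexp_intg ezeta.
  have := is_condexpB mUL (iZp P) iz z2 (is_condexp_comp (V := UL) mzs iz).
  by congr is_condexp; apply/funext => ul /=; rewrite subrr.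
have iZc : intg P Zc by exact: (intg_bounded mZc Zck).
have ihZc : intg P (fun w => h (UL w) * Zc w).
  rewrite (_ : (fun w => _) = fun w => Zc w * h (UL w)).
    exact: (intgMl mZc ih Zck).
  by apply/funext => w; rewrite mulrC.
have E1 := is_condexp_mull mUL iZc mh eZc0 ihZc.
pose f2 (zl : TZ * TL) := (pi zl - zeta zl.2) * f zl.
have mf2 : measurable_fun setT f2.
  apply: measurable_funM => //; apply: measurable_funB => //.
  exact: (measurableT_comp mzeta measurable_snd).
have if2 : intg P (f2 \o ZL) by exact: (intgMl mZc if_ Zck).
have eg2 := condexpP mL if2; set g2 := condexp P L _ in eg2.
have E2 := cond_indep_condexp mZ mU mL ZU mf2 if2 eg2.
have iphZp : intg P (fun w => phiL (L w) * (Zc w * p w)).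
  exact: (intgMl mphiLL iZcp phiL1).
have E3 : is_condexp P UL (fun w => phiL (L w) * (Zc w * p w)) (g2 \o snd).
  have := is_condexpD mUL ihZc if2 E1 E2.
  rewrite (_ : (fun ul => _ + _) = g2 \o snd); last first.
    by apply/funext => ul; rewrite /= mulr0 add0r.
  apply: (is_condexp_ae_eq_arg mUL).
  - exact: (intg_measurable (intgD ihZc if2)).
  - exact: intg_measurable iphZp.
  - by apply: filterS pE => w ->; rewrite /h /f2 /f /Zc /Zp /=; ring.
have mphiLs : measurable_fun setT (fun ul : TU * TL => phiL ul.2).
  exact: (measurableT_comp mphiL measurable_snd).
have E4 := is_condexp_mull mUL iZcp mphiLs en iphZp.
have E5 := is_condexp_mull mL iZcp mphiL eD iphZp.
have E6 : is_condexp P L (fun w => g2 (L w)) (fun l => phiL l * D l).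
  exact: (is_condexp_tower (phi := snd) measurable_snd E3 E5).
have ig2 : intg P (fun w => g2 (L w)) := is_condexp_intg eg2.
have E7 : is_condexp P L (fun w => g2 (L w)) g2.
  exact: (is_condexp_comp (V := L) (is_condexp_measurable eg2) ig2).
(* Uniqueness of versions given (U, L) equates [g2] with phiL n, and given [L] with phiL D;
   cancelling phiL leaves n = D. *)
have om_1 : {ae P, forall w, m (UL w) * om (UL w) = m (UL w)}.
  have u1 := is_condexp_uniq mUL E3 E4; have u2 := is_condexp_uniq mL E6 E7.
  have u12 : {ae P, forall w, phiL (L w) * n (UL w) = phiL (L w) * D (L w)}.
    by apply: filterS2 u1 u2 => w /= <- ->.
  apply: filterS3 u12 phiL0 D_neq0 => w e pos D0.
  have nD : n (UL w) = D (L w) by apply: mulfI e; rewrite gt_eqF.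
  by rewrite omE /= nD mulVf// mulr1.
have imom := is_condexp_intg m_om_condexp.
rewrite integral_mu_o (eq_integral_ae measurableT (intg_measurable imom) mmUL om_1).
by rewrite (is_condexp_integral em).
Qed.

End weighting.

(** * The theorem, with the kernel value at [a] taken for [Q] *)

Theorem theorem3p1 (R : realType) (d : measure_display) (T : measurableType d)
  (P : probability T R) (dZ dU dL : nat)
  (Y A : {RV P >-> R}) (Ypot : R -> {RV P >-> R})
  (Z : {RV P >-> dZ.-tuple R}) (U : {RV P >-> dU.-tuple R})
  (L : {RV P >-> dL.-tuple R})
  (K : R.-pker (measurableTypeR R) ~> T)
  (hK : is_cond_prob_given P A K)
  (pA : R -> R) (hpA : is_density P A pA)
  (pAL : R -> dL.-tuple R -> R)
  (hpAL : is_cond_density P A K pA L pAL)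
  (pAZL : R -> dZ.-tuple R * dL.-tuple R -> R)
  (hpAZL : is_cond_density P A K pA (fun w => (Z w, L w)) pAZL)
  (pAZUL : R -> dZ.-tuple R * dU.-tuple R * dL.-tuple R -> R)
  (hpAZUL : is_cond_density P A K pA (fun w => (Z w, U w, L w)) pAZUL)
  (hoverlap : overlap P A L pAL)
  (hconsistency : consistency A Y Ypot)
  (hignorability : latent_ignorability P A Ypot Z U L K)
  (hIV : IV_independence P Z U L)
  (hcontinuity : continuity_boundedness P A Z L pAZL)
  (hpositivity : positivity P A L pAL)
  (a : R) (ha : interior (rv_support P A) a)
  (intYa : P.-integrable setT (EFin \o Ypot a))
  (intY : (K a).-integrable setT (EFin \o Y))
  (pi : dZ.-tuple R * dL.-tuple R -> R)
  (hpi : is_RWF P Z L K pi a) :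
  let m := condexp P (fun w => (U w, L w)) (Ypot a) in
  let om := omega P Z U L pi pAZUL a in
  [/\ ('E_P[fun w => mu_o P Y Z L K pi a (L w)] =
       'E_P[fun w => (m (U w, L w) * om (U w, L w))%R])%E,
      ('E_P[fun w => mu_o P Y Z L K pi a (L w)] - 'E_P[Ypot a] =
       'E_P[fun w => condcov P L (fun w => m (U w, L w))
                       (fun w => om (U w, L w)) (L w)])%E &
      is_AIV P Z U L pAZUL a ->
      ('E_P[Ypot a] = 'E_P[fun w => mu_o P Y Z L K pi a (L w)])%E].
Proof.
have K1 : K a setT = 1%E by exact: prob_kernel.
have [Q QE] := probability_of_measure K1.
have QKa B : Q B = K a B by rewrite -QE.
have [mA0 pA0 _] := hpA.
(* The last clause of a conditional density is Bayes' rule at [a]; the slice at [a] is measurable by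
   joint measurability. *)
have bayes d' (T' : measurableType d') (V : T -> T') p :
    is_cond_density P A K pA V p -> bayes_density P Q (pA a) V (p a).
  case=> mp p0 _ pE; split => //; last by move=> C mC; rewrite QKa; exact: pE.
  have mpair : measurable_fun setT (fun v : T' => ((a : measurableTypeR R), v)).
    by apply: measurable_fun_pair => //; exact: measurable_cst.
  exact: (measurableT_comp mp mpair).
have LB := bayes _ _ _ _ hpAL; have ZLB := bayes _ _ _ _ hpAZL.
have ZULB := bayes _ _ _ _ hpAZUL.
have [mpi [k pik] [e2 e20 kape2]] := hpi.
have [_ [M pM]] := hcontinuity a ha; have [e1 e10 pe1] := hpositivity a ha.
have [_ ign] := hignorability a ha.
(* [K a] is carried by the event A = a, on which consistency reads Y = Y(a). *)
have YE : {ae Q, forall w, Y w = Ypot a w}.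
  have mAa : measurable (A @^-1` [set a]).
    by rewrite -[X in measurable X]setTI; exact: measurable_funP.
  exists (~` (A @^-1` [set a])); split.
  - exact: measurableC.
  - by rewrite probability_setC// QKa (hK.2 a ha) subee.
  - by move=> w; apply: contra_not => <-; exact: hconsistency.
rewrite /kappa -QE in kape2; rewrite -QE in intY ign.
rewrite !unlock /mu_o -QE.
have mZ : measurable_fun setT Z := measurable_funP Z.
have mU : measurable_fun setT U := measurable_funP U.
have mL : measurable_fun setT L := measurable_funP L.
have mY : measurable_fun setT Y := measurable_funP Y.
have mYa : measurable_fun setT (Ypot a) := measurable_funP (Ypot a).
split.
- exact: (integral_mu_o mZ mU mL mY mYa mpi (pA0 a) ZULB LB ign intYa intY YE
    hIV e10 e20 pe1 pik kape2).
- apply: esym; exact: (integral_condcov_m_om mZ mU mL mY mYa mpi (pA0 a) ZULB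
    ZLB LB ign intYa intY YE hIV pM e10 e20 pe1 pik kape2).
- exact: (AIV_integral_mu_o mZ mU mL mY mYa mpi (pA0 a) ZULB LB ign intYa intY
    YE hIV e10 e20 pe1 pik kape2).
Qed.
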